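(* Let $X$ be any $n\times n$ real matrix. If the eigenvalues of the symmetric part of $X$, $\frac{X+X^T}{2}$, are all nonzero reals that have the same sign, then $G_X=\{e^{tX}:t\in\mathbb{R}\}$ is admissible.
   Context: Let $G$ be a closed subgroup of $GL_n(\mathbb{R})$ with a left Haar measure $\mu$. Let $G_\#$ be the group of pairs $(a,b)\in G\times\mathbb{R}^n$ with multiplication $(\alpha,\beta)\cdot(a,b)=(\alpha a,\,b+a^{-1}\beta)$, with left Haar measure $d\lambda(a,b)=d\mu(a)\,db$. For $\psi\in L^2(\mathbb{R}^n)$ set $\psi_{(a,b)}(x)=|\det(a)|^{-1/2}\psi(a^{-1}x-b)$. A function $\psi\in L^2(\mathbb{R}^n)$ is called a continuous wavelet for $G$ if $f=\int_{G_\#}\langle f,\psi_{(a,b)}\rangle\psi_{(a,b)}\,d\lambda(a,b)$ for all $f\in L^2(\mathbb{R}^n)$. By a known result, this is equivalent to the condition $$\Delta_\psi(\xi):=\int_G|\hat\psi(a^T\xi)|^2\,d\mu(a)=1\quad\text{for almost every }\xi\in\mathbb{R}^n\setminus\{0\},$$ where $a^T$ is the transpose of $a$ and $\hat\psi$ is the Fourier transform of $\psi$ (normalized to be unitary on $L^2(\mathbb{R}^n)$). The group $G$ is called admissible if it admits a continuous wavelet, i.e. if there exists $\psi\in L^2(\mathbb{R}^n)$ satisfying $\Delta_\psi(\xi)=1$ for almost every $\xi\in\mathbb{R}^n\setminus\{0\}$. *)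

(* Defs.v *)
From HB Require Import structures.
From mathcomp Require Import all_boot all_order all_algebra.
From mathcomp Require Import all_classical all_reals all_analysis.
From mathcomp Require Import measurable_realfun complex.

Set Implicit Arguments.
Unset Strict Implicit.
Unset Printing Implicit Defensive.

Import Order.TTheory GRing.Theory Num.Def Num.Theory.
Import numFieldNormedType.Exports.

Local Open Scope classical_set_scope.
Local Open Scope ring_scope.

Import Normc.

(* Conventions.
   - R^n is the space of column vectors 'cV[R]_n, acted on by a |-> a *m x.
   - Matrices carry the Borel sigma-algebra of their usual topology.
   - The Fourier transform is normalized by
       f^(xi) = int f(x) exp(- 2 i pi <x, xi>) dx.
   - A function in L^2 is a representative of its a.e. class, and [normc] is
     the complex modulus with values in R. *)

Fact borel_mx_display : measure_display. Proof. by []. Qed.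

Section borel_mx.
Variables (R : realType) (m n : nat).

Definition borel_mx : set (set 'M[R]_(m, n)) := <<s open >>.

Let borel_mx0 : borel_mx set0.
Proof. exact: sigma_algebra0. Qed.

Let borel_mxC A : borel_mx A -> borel_mx (~` A).
Proof. exact: sigma_algebraC. Qed.

Let borel_mx_bigcup (F : (set 'M[R]_(m, n))^nat) :
  (forall i, borel_mx (F i)) -> borel_mx (\bigcup_i F i).
Proof. exact: sigma_algebra_bigcup. Qed.

HB.instance Definition _ := @isMeasurable.Build borel_mx_display
  'M[R]_(m, n) borel_mx borel_mx0 borel_mxC borel_mx_bigcup.

Lemma open_measurable_mx (U : set 'M[R]_(m, n)) : open U -> measurable U.
Proof. by move=> oU; apply: sub_gen_smallest. Qed.

Lemma measurable_fun_mx d (T : measurableType d) (f : T -> 'M[R]_(m, n)) :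
  (forall U, open U -> measurable (f @^-1` U)) -> measurable_fun setT f.
Proof.
move=> fU.
apply: (@measurability _ _ _ _ setT f (@open 'M[R]_(m, n)) (erefl _)).
by move=> _ [U oU <-]; rewrite setTI; exact: fU.
Qed.

End borel_mx.

Section lebesgue_cV.
Variable R : realType.

Definition cons_cV n (p : R * 'cV[R]_n) : 'cV[R]_n.+1 := col_mx p.1%:M p.2.

Lemma ball_cVP n (v w : 'cV[R]_n) (e : R) : 0 < e ->
  ball v e w <-> forall i, ball (v i 0) e (w i 0).
Proof.
move=> e0; split=> [vw i|H]; first by case: vw => _; exact.
by split=> // i j; rewrite ord1; exact: H.
Qed.

Lemma cons_cV_ball n (v : 'cV[R]_n.+1) (e : R) : 0 < e ->
  @cons_cV n @^-1` ball v e =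
  ball (usubmx (v : 'cV_(1 + n)) 0 0) e `*` ball (dsubmx (v : 'cV_(1 + n))) e.
Proof.
move=> e0; apply/seteqP; split => -[x w]; rewrite /preimage /=.
  move/(ball_cVP _ _ e0) => H; split.
    have := H (lshift n (0 : 'I_1)).
    by rewrite /cons_cV /= [X in ball _ _ X]col_mxEu !mxE eqxx mulr1n.
  apply/(ball_cVP _ _ e0) => i; have := H (rshift 1 i).
  by rewrite /cons_cV /= [X in ball _ _ X]col_mxEd !mxE.
move=> [H0 /(ball_cVP _ _ e0) H]; apply/(ball_cVP _ _ e0) => i.
have -> : i = unsplit (fintype.split (i : 'I_(1 + n))) by rewrite fintype.splitK.
case: (fintype.split _) => k /=.
  rewrite /cons_cV [X in ball _ _ X]col_mxEu !mxE !ord1 eqxx mulr1n.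
  by move: H0; rewrite !mxE.
by rewrite /cons_cV [X in ball _ _ X]col_mxEd; have := H k; rewrite !mxE.
Qed.

Lemma open_bigcup_cube n (U : set 'cV[R]_n) : open U ->
  U = \bigcup_(p in [set p : 'cV[rat]_n * nat |
         ball (map_mx ratr p.1 : 'cV[R]_n) p.2.+1%:R^-1 `<=` U])
        ball (map_mx ratr p.1 : 'cV[R]_n) p.2.+1%:R^-1.
Proof.
move=> oU; apply/seteqP; split=> [v Uv|v [p /= pU /pU]//].
have /nbhs_ballP[e /= e0 veU] : nbhs v U by exact: open_nbhs_nbhs.
pose k := truncn (2 / e).
have k0 : (0 : R) < k.+1%:R^-1 by rewrite invr_gt0.
have ke : k.+1%:R^-1 + k.+1%:R^-1 <= e.
  rewrite -mulr2n -[_ *+ 2]mulr_natl ler_pdivrMr// mulrC -ler_pdivrMr//.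
  by rewrite ltW// truncnS_gt.
have H (x : R) : exists q : rat, `|x - ratr q| < k.+1%:R^-1.
  have [q] : exists q : rat, ratr q \in `]x - k.+1%:R^-1, x + k.+1%:R^-1[.
    by apply: rat_in_itvoo; rewrite ltrD2l gt0_cp.
  rewrite in_itv/= => /andP[xq qx]; exists q.
  by rewrite distrC ltr_distl xq.
have /choice[f Hf] := H.
have vf : ball (map_mx ratr (map_mx f v) : 'cV[R]_n) k.+1%:R^-1 v.
  by apply: ball_sym; split=> // i j; rewrite !mxE; exact: Hf.
exists (map_mx f v, k) => //= w fw; apply: veU.
exact: le_ball ke _ (ball_triangle (ball_sym vf) fw).
Qed.

Lemma measurable_cons_cV n : measurable_fun setT (@cons_cV n).
Proof.
apply: measurable_fun_mx => U oU; rewrite (open_bigcup_cube oU) preimage_bigcup.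
rewrite bigcup_mkcond; apply: countable_bigcupT_measurable.
  exact: countableP.
move=> p; case: ifPn => // _.
rewrite cons_cV_ball ?invr_gt0//; apply: measurableX.
  exact: measurable_ball.
by apply: open_measurable_mx; exact: ball_open.
Qed.

Definition head_cV n (v : 'cV[R]_n.+1) : R := v 0 0.
Definition tail_cV n (v : 'cV[R]_n.+1) : 'cV[R]_n := dsubmx (v : 'cV_(1 + n)).

Lemma measurable_coord_mx m n i j :
  measurable_fun setT (fun M : 'M[R]_(m, n) => M i j).
Proof.
apply: (measurability _ (RGenOpens.measurableE R)).
move=> _ [_ [a [b ->]] <-]; rewrite setTI; apply: open_measurable_mx.
by move/continuousP: (@coord_continuous R m n i j); apply; exact: interval_open.
Qed.

Lemma measurable_tail_cV n : measurable_fun setT (@tail_cV n).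
Proof.
apply: measurable_fun_mx => U; rewrite openE => oU.
apply: open_measurable_mx; rewrite openE => v /= /oU.
rewrite /interior -!nbhs_ballE => -[e /= e0 veU].
exists e => //= w /(ball_cVP _ _ e0) H; apply: veU.
by apply/(ball_cVP _ _ e0) => i; rewrite !mxE.
Qed.

Lemma headtailK n (p : R * 'cV[R]_n) :
  (head_cV (cons_cV p), tail_cV (cons_cV p)) = p.
Proof.
case: p => x w; congr (_, _); last by rewrite /tail_cV /cons_cV col_mxKd.
rewrite /head_cV /cons_cV /=.
have -> : (0 : 'I_n.+1) = lshift n (0 : 'I_1) by exact/val_inj.
by rewrite [LHS]col_mxEu mxE eqxx mulr1n.
Qed.

Section lebesgue_cV_succ.
Variables (n : nat) (m : {sigma_finite_measure set 'cV[R]_n -> \bar R}).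

Definition lebesgue_cV_succ : set 'cV[R]_n.+1 -> \bar R :=
  pushforward (lebesgue_measure \x m)%E (@cons_cV n).

Let lebesgue_cV_succ_measure : {measure set 'cV[R]_n.+1 -> \bar R} :=
  measure_function_pushforward__canonical__measure_function_Measure
    (lebesgue_measure \x m)%E (@measurable_cons_cV n).

HB.instance Definition _ :=
  Measure.copy lebesgue_cV_succ lebesgue_cV_succ_measure.

Let lebesgue_cV_succ_sigma_finite : sigma_finite setT lebesgue_cV_succ.
Proof.
have [F FT Foo] : sigma_finite setT (lebesgue_measure \x m)%E.
  have /sigma_finiteP[F [TF ndF Foo]] := sigma_finiteT (@lebesgue_measure R).
  have /sigma_finiteP[G [TG ndG Goo]] := sigma_finiteT m.
  exists (fun n => F n `*` G n).
    rewrite -setXTT TF TG predeqE => -[x y]; split.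
      move=> [/= [i _ Fix] [k _ Gky]]; exists (maxn i k) => //; split.
      - by move: x Fix; exact/subsetPset/ndF/leq_maxl.
      - by move: y Gky; exact/subsetPset/ndG/leq_maxr.
    by move=> [i _ []/= ? ?]; split; exists i.
  move=> k; have [? ?] := Foo k; have [? ?] := Goo k.
  split; first exact: measurableX.
  by rewrite product_measure1E// lte_mul_pinfty// ge0_fin_numE.
exists (fun i => (fun v => (head_cV v, tail_cV v)) @^-1` F i).
  by rewrite -preimage_bigcup -FT preimage_setT.
move=> i; have [mF Fi] := Foo i; split.
  rewrite -[X in measurable X]setTI; apply: measurable_fun_pair => //.
    exact: measurable_coord_mx.
  exact: measurable_tail_cV.
rewrite [X in (X < _)%E](_ : _ = (lebesgue_measure \x m)%E (F i))//.
congr (product_measure1 _ _ _); apply/funext => p.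
by rewrite /preimage /mkset headtailK.
Qed.

HB.instance Definition _ := Measure_isSigmaFinite.Build _ _ _
  lebesgue_cV_succ lebesgue_cV_succ_sigma_finite.

End lebesgue_cV_succ.

Fixpoint lebesgue_cV n : {sigma_finite_measure set 'cV[R]_n -> \bar R} :=
  if n is n'.+1 then lebesgue_cV_succ (lebesgue_cV n') else \d_(0 : 'cV[R]_0).

(* This determines [lebesgue_cV n] among the Borel measures. *)
Lemma lebesgue_cV_box n (A : 'I_n -> set R) : (forall i, measurable (A i)) ->
  lebesgue_cV n [set v | forall i, A i (v i 0)] =
  (\prod_(i < n) lebesgue_measure (A i))%E.
Proof.
elim: n A => [|n IHn] A mA.
  rewrite big_ord0 /= diracE mem_set//.
  by move=> -[].
rewrite big_ord_recl -IHn//= /lebesgue_cV_succ /pushforward.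
have mB : measurable [set w : 'cV[R]_n | forall i, A (lift ord0 i) (w i 0)].
  rewrite (_ : [set _ | _] = \bigcap_(i in setT)
      ((fun w : 'cV[R]_n => w i 0) @^-1` A (lift ord0 i))); last first.
    by apply/seteqP; split=> w H i; [move=> _|]; exact: H.
  apply: fin_bigcap_measurable => // i _.
  by rewrite -[X in measurable X]setTI; exact: measurable_coord_mx.
rewrite -product_measure1E//; last exact: mA.
congr (_ _); apply/seteqP; split => -[x w]; rewrite /cons_cV /=.
  move=> H; split=> [|i].
    have := H (lshift n (0 : 'I_1)); rewrite [X in A _ X]col_mxEu mxE eqxx mulr1n.
    by congr (A _ _); exact/val_inj.
  have := H (rshift 1 i); rewrite [X in A _ X]col_mxEd.
  by congr (A _ _); exact/val_inj.
move=> [H0 H] i; have -> : i = unsplit (fintype.split (i : 'I_(1 + n))).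
  by rewrite fintype.splitK.
case: (fintype.split _) => k /=.
  rewrite [X in A _ X]col_mxEu !ord1 mxE eqxx mulr1n.
  by move: H0; congr (A _ _); exact/val_inj.
rewrite [X in A _ X]col_mxEd.
by move: (H k); congr (A _ _); exact/val_inj.
Qed.

End lebesgue_cV.

Section fourier.
Variables (R : realType) (n : nat).
Local Notation mu := (@lebesgue_cV R n).
Implicit Types f g psi : 'cV[R]_n -> R[i].

Definition dot_cV (x y : 'cV[R]_n) : R := (x^T *m y) 0 0.

(* exp (i t) *)
Definition cis (t : R) : R[i] := Complex (cos t) (sin t).

Definition measurable_funC f :=
  measurable_fun setT (fun x => complex.Re (f x)) /\
  measurable_fun setT (fun x => complex.Im (f x)).

Definition LnormC (p : \bar R) f : \bar R :=
  Lnorm mu p (fun x => (normc (f x))%:E).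

Definition LfunC (p : \bar R) f := measurable_funC f /\ (LnormC p f < +oo)%E.

Definition integralC f : R[i] :=
  Complex (\int[mu]_x complex.Re (f x)) (\int[mu]_x complex.Im (f x)).

Definition fourierL1 f (xi : 'cV[R]_n) : R[i] :=
  integralC (fun x => f x * cis (- (2 * pi * dot_cV x xi))).

Definition cvgL2 (f_ : nat -> 'cV[R]_n -> R[i]) f :=
  LnormC 2%:E (fun x => f_ k x - f x) @[k --> \oo] --> 0%E.

(* The Fourier transform on L^2 is the extension by density of [fourierL1] from
   L^1 `&` L^2; it is only defined up to a.e. equality, hence a relation. *)
Definition is_fourierL2 psi psihat :=
  [/\ LfunC 2%:E psi, LfunC 2%:E psihat &
      exists f_ : nat -> 'cV[R]_n -> R[i],
        [/\ forall k, LfunC 1%:E (f_ k) /\ LfunC 2%:E (f_ k),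
            cvgL2 f_ psi & cvgL2 (fun k => fourierL1 (f_ k)) psihat]].

End fourier.

Section admissible.
Variables (R : realType) (n : nat).
Implicit Types (G : set 'M[R]_n) (mu : {measure set 'M[R]_n -> \bar R}).

Definition closed_subgroup_GL G :=
  [/\ G `<=` [set a | a \in unitmx],
      G 1%:M,
      forall a b, G a -> G b -> G (a *m b),
      forall a, G a -> G (invmx a) &
      closure G `&` [set a | a \in unitmx] `<=` G].

(* A measure on G is seen as a Borel measure on matrices carried by G. Its
   regularity is not required: it follows from local finiteness since G is
   locally compact and second countable. *)
Definition left_haar_measure G mu :=
  [/\ mu (~` G) = 0%E,
      (0 < mu G)%E,
      forall K, compact K -> K `<=` G -> (mu K < +oo)%E &
      forall a E, G a -> measurable E -> mu ((fun b => a *m b) @` E) = mu E].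

Definition Delta G mu (psihat : 'cV[R]_n -> R[i]) (xi : 'cV[R]_n) : \bar R :=
  (\int[mu]_(a in G) ((normc (psihat (a^T *m xi))) ^+ 2)%:E)%E.

(* The choice of the left Haar measure is immaterial, as it is unique up to a
   positive factor; existence is stated so that the last clause is not
   vacuous. *)
Definition admissible G :=
  [/\ closed_subgroup_GL G,
      exists mu, left_haar_measure G mu &
      forall mu, left_haar_measure G mu ->
        exists psi psihat : 'cV[R]_n -> R[i],
          is_fourierL2 psi psihat /\
          {ae lebesgue_cV R n, forall xi, xi != 0 -> Delta G mu psihat xi = 1%E}].

Definition expmx (X : 'M[R]_n) : 'M[R]_n :=
  lim (series (fun k => k`!%:R^-1 *: X ^+ k) @ \oo).

(* The eigenvalues are taken in the complex numbers. *)
Definition eigenvalues_same_sign (S : 'M[R]_n) :=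
  let eig z := eigenvalue (map_mx (real_complex R) S) z in
  (forall z : R[i], eig z -> exists2 r : R, z = (r%:C)%C & 0 < r) \/
  (forall z : R[i], eig z -> exists2 r : R, z = (r%:C)%C & r < 0).

End admissible.

(* Main.v *)
Require Import Defs.
From HB Require Import structures.
From mathcomp Require Import all_boot all_order all_algebra.
From mathcomp Require Import all_classical all_reals all_analysis.
From mathcomp Require Import measurable_realfun complex ring lra.

Set Implicit Arguments.
Unset Strict Implicit.
Unset Printing Implicit Defensive.

Import Order.TTheory GRing.Theory Num.Def Num.Theory.
Import numFieldNormedType.Exports.

Local Open Scope classical_set_scope.
Local Open Scope ring_scope.

(** Replacing X by -X does not change the group, so assume that the symmetric
    part of X is positive definite and write phi t = e^{tX}. Then |phi(t)^T x|^2
    has derivative 2 Q(phi(t)^T x) with Q x = <x, X^T x> >= c |x|^2, so for x <> 0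
    it increases from 0 to +oo; hence t |-> phi t is proper, and the group is a
    closed copy of the real line. For H x = 2 Q(x) e^{-|x|^2}, the function
    t |-> H(phi(t)^T x) is the derivative of - e^{-|phi(t)^T x|^2}, so its
    integral over the line is 1 for all x <> 0. For a left Haar measure mu, the
    integral of H(a^T x) over the group is thus a constant m independent of x, and
    sqrt (H / m) is the Fourier transform sought. It is continuous and decays
    exponentially, which makes it the L^2 Fourier transform of some function. *)

(** * The one-dimensional Laplace and Poisson kernels *)

(** Two obstacles shape the proof. First, an L^2 Fourier transform is only available as an L^2 limit
    of transforms of functions in L^1 and L^2, so producing psi takes Fourier inversion together
    with a bound on the L^2 norm of psi. The inverse integral of psihat is damped by exp(- 2 pi e
    (|x_1| + ... + |x_n|)): the transform of this factor is a product of Poisson kernels, so that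
    all explicit integrals factor over the coordinates and have elementary antiderivatives. One
    Fubini exchange then gives the transforms of the damped functions, and another the bound on
    |psi|^2. Second, mu is an arbitrary left Haar measure. Rather than identifying it with a
    multiple of dt, a Fubini argument on G x R shows that the integral of H(a^T x) equals the
    measure of a fixed piece of the group, which does not involve x. Any smooth decreasing profile
    of |x|^2 going from 1 to 0 would give an H of total mass 1 along the orbits; the Gaussian one
    moreover makes sqrt H bounded and integrable. *)

Section laplace.
Variable R : realType.
Local Notation leb := (@lebesgue_measure R).

Definition laplace (a x : R) := expR (- (a * `|x|)).

Lemma laplace_gt0 a x : 0 < laplace a x.
Proof. exact: expR_gt0. Qed.

Lemma laplaceN a x : laplace a (- x) = laplace a x.
Proof. by rewrite /laplace normrN. Qed.

Lemma laplace_le1 a x : 0 <= a -> laplace a x <= 1.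
Proof. by move=> a0; rewrite -expR0 ler_expR oppr_le0 mulr_ge0. Qed.

Lemma continuous_laplace a : continuous (laplace a).
Proof.
move=> x; apply: (@continuous_comp _ _ _ (fun x => - (a * `|x|)) expR).
  by apply: cvgN; apply: cvgMl_tmp; exact: norm_continuous.
exact: continuous_expR.
Qed.

Lemma cvg_expRNM a : 0 < a -> expR (- (a * x)) @[x --> +oo] --> (0 : R).
Proof.
move=> a0; apply: (cvg_comp (fun x => a * x) (fun x => expR (- x))).
  exact: gt0_cvgMry.
exact: cvgr_expR.
Qed.

(* The summand 1 makes the integrand nonnegative. *)
Lemma integral_laplace1cos a b : 0 < a ->
  (\int[leb]_x (laplace a x * (1 + cos (b * x)))%:E =
   (2 / a + 2 * a / (a ^+ 2 + b ^+ 2))%:E)%E.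
Proof.
move=> a0.
have ab0 : a ^+ 2 + b ^+ 2 != 0.
  by rewrite gt_eqF// ltr_wpDr ?sqr_ge0// exprn_gt0.
have a_neq0 : a != 0 by rewrite gt_eqF.
have c1 x : 0 <= 1 + cos (b * x) by rewrite -lerBlDl sub0r cos_geN1.
rewrite ge0_symfun_integralT; last 3 first.
- by move=> x; rewrite mulr_ge0// ltW// laplace_gt0.
- move=> x; apply: cvgM; first exact: continuous_laplace.
  apply: cvgD; first exact: cvg_cst.
  apply: (@continuous_comp _ _ _ (fun x => b * x) cos).
    by apply: cvgMl_tmp; exact: cvg_id.
  exact: continuous_cos.
- by move=> x; rewrite /= laplaceN mulrN cosN.
rewrite -set_itvcy.
under eq_integral => x.
  rewrite inE/= in_itv/= andbT => x0; rewrite /laplace ger0_norm//.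
  over.
(* The second summand is the classical antiderivative of e^{-ax} cos(bx). As F tends to 0 at +oo,
   the half-line integral is - F 0, and evenness doubles it. *)
pose F (x : R) := - a^-1 * expR (- (a * x)) +
  (a ^+ 2 + b ^+ 2)^-1 * (expR (- (a * x)) * (b * sin (b * x) - a * cos (b * x))).
have dF (x : R) : is_derive x (1 : R) F (expR (- (a * x)) * (1 + cos (b * x))).
  apply: trigger_derive; rewrite /GRing.scale/=.
  by field; rewrite ab0.
rewrite (@ge0_continuous_FTC2y _ _ F 0 0).
- rewrite /F !mulr0 oppr0 expR0 sin0 cos0 -EFinB -EFinM; congr EFin.
  by field; rewrite ab0.
- by move=> x _; rewrite mulr_ge0// expR_ge0.
- apply: continuous_subspaceT => x; apply: cvgM.
    apply: (@continuous_comp _ _ _ (fun x => - (a * x)) expR).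
      by apply: cvgN; apply: cvgMl_tmp; exact: cvg_id.
    exact: continuous_expR.
  apply: cvgD; first exact: cvg_cst.
  apply: (@continuous_comp _ _ _ (fun x => b * x) cos).
    by apply: cvgMl_tmp; exact: cvg_id.
  exact: continuous_cos.
- apply: norm_cvg0; pose c := a^-1 + (a ^+ 2 + b ^+ 2)^-1 * (`|b| + a).
  have : c * expR (- (a * x)) @[x --> +oo] --> c * 0.
    by apply: cvgMl_tmp; exact: cvg_expRNM.
  rewrite mulr0 => h; apply: squeeze_cvgr h; last exact: cvg_cst.
  near=> x; rewrite normr_ge0/= /F /c mulrDl.
  apply: le_trans (ler_normD _ _) _; apply: lerD.
    by rewrite normrM normrN !ger0_norm ?expR_ge0// invr_ge0 ltW.
  rewrite !normrM -mulrA ger0_norm; last first.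
    by rewrite invr_ge0 addr_ge0 ?sqr_ge0.
  rewrite ler_wpM2l ?invr_ge0 ?addr_ge0 ?sqr_ge0// ger0_norm ?expR_ge0//.
  rewrite mulrC ler_wpM2r ?expR_ge0//.
  apply: le_trans (ler_normB _ _) _; rewrite !normrM (gtr0_norm a0) lerD//.
    by rewrite ler_piMr// ler_norml sin_geN1 sin_le1.
  by rewrite ler_piMr ?(ltW a0)// ler_norml cos_geN1 cos_le1.
- by move=> x _; exact: ex_derive.
- have : {for 0, continuous F}.
    by apply/differentiable_continuous/derivable1_diffP; exact: ex_derive.
  by move=> cF; exact: cvg_at_right_filter cF.
- by move=> x _; rewrite derive1E; exact: derive_val.
Unshelve. all: by end_near. Qed.

Lemma measurable_laplace a : measurable_fun setT (laplace a).
Proof. by apply: continuous_measurable_fun; exact: continuous_laplace. Qed.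

(** At b = 0 the preceding identity says that twice the integral is 4 / a; the case analysis
    discards infinite values. *)
Lemma integral_laplace a : 0 < a ->
  (\int[leb]_x (laplace a x)%:E = (2 / a)%:E)%E.
Proof.
move=> a0; have := integral_laplace1cos 0 a0.
under eq_integral do rewrite mul0r cos0 mulrDr mulr1 EFinD.
rewrite ge0_integralD//; last 4 first.
- by move=> x _; rewrite lee_fin ltW// laplace_gt0.
- by apply/measurable_EFinP; exact: measurable_laplace.
- by move=> x _; rewrite lee_fin ltW// laplace_gt0.
- by apply/measurable_EFinP; exact: measurable_laplace.
have : (0 <= \int[leb]_x (laplace a x)%:E)%E.
  by apply: integral_ge0 => x _; rewrite lee_fin ltW// laplace_gt0.
case: (\int[leb]_x (laplace a x)%:E)%E => [r _| |]//.
rewrite expr0n/= addr0 -EFinD => -[] H; congr EFin.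
have a_neq0 : a != 0 by rewrite gt_eqF.
have : 2 * a / a ^+ 2 = 2 / a by field.
move: H => /[swap] -> H; lra.
Qed.

Lemma integrable_laplace a : 0 < a ->
  leb.-integrable setT (EFin \o laplace a).
Proof.
move=> a0; apply/integrableP; split.
  by apply/measurable_EFinP; exact: measurable_laplace.
under eq_integral do rewrite /= ger0_norm ?(ltW (laplace_gt0 _ _))//.
by rewrite integral_laplace// ltry.
Qed.

Lemma integrableMbounded d (T : measurableType d)
    (m : {measure set T -> \bar R}) (f u : T -> R) (B : R) :
  m.-integrable setT (EFin \o f) -> measurable_fun setT u ->
  (forall x, `|u x| <= B) -> m.-integrable setT (EFin \o (f \* u)).
Proof.
move=> fi mu uB; have mf : measurable_fun setT f.
  by apply/measurable_EFinP; exact: measurable_int fi.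
apply: (@le_integrable _ _ _ m _ measurableT _ (fun x => B%:E * (EFin \o f) x)%E).
- exact/measurable_EFinP/measurable_funM.
- move=> x _; rewrite [(EFin \o f) x]/= -EFinM /= lee_fin !normrM mulrC.
  by rewrite ler_wpM2r// (le_trans (uB x))// ler_norm.
- exact: integrableZl.
Qed.

Lemma measurable_cosM b : measurable_fun setT (fun x : R => cos (b * x)).
Proof.
apply: continuous_measurable_fun => x.
apply: (@continuous_comp _ _ _ (fun x => b * x) cos); last exact: continuous_cos.
by apply: cvgMl_tmp; exact: cvg_id.
Qed.

Lemma measurable_sinM b : measurable_fun setT (fun x : R => sin (b * x)).
Proof.
apply: continuous_measurable_fun => x.
apply: (@continuous_comp _ _ _ (fun x => b * x) sin); last exact: continuous_sin.
by apply: cvgMl_tmp; exact: cvg_id.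
Qed.

Lemma norm_cos_le1 (x : R) : `|cos x| <= 1.
Proof. by rewrite ler_norml cos_geN1 cos_le1. Qed.

Lemma norm_sin_le1 (x : R) : `|sin x| <= 1.
Proof. by rewrite ler_norml sin_geN1 sin_le1. Qed.

Lemma integrable_laplace_cos a b : 0 < a ->
  leb.-integrable setT (EFin \o (fun x => laplace a x * cos (b * x))).
Proof.
move=> a0; apply: (integrableMbounded (integrable_laplace a0) _ (B := 1)).
  exact: measurable_cosM.
by move=> x; exact: norm_cos_le1.
Qed.

Lemma integrable_laplace_sin a b : 0 < a ->
  leb.-integrable setT (EFin \o (fun x => laplace a x * sin (b * x))).
Proof.
move=> a0; apply: (integrableMbounded (integrable_laplace a0) _ (B := 1)).
  exact: measurable_sinM.
by move=> x; exact: norm_sin_le1.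
Qed.

Lemma Rintegral_laplace_cos a b : 0 < a ->
  \int[leb]_x (laplace a x * cos (b * x)) = 2 * a / (a ^+ 2 + b ^+ 2).
Proof.
move=> a0; have H : \int[leb]_x (laplace a x * (1 + cos (b * x))) =
    2 / a + 2 * a / (a ^+ 2 + b ^+ 2).
  by rewrite /Rintegral integral_laplace1cos.
move: H; under eq_Rintegral do rewrite mulrDr mulr1.
rewrite RintegralD//; last 2 first.
- exact: integrable_laplace.
- exact: integrable_laplace_cos.
by rewrite [X in X + _ = _]/Rintegral integral_laplace//= => /addrI.
Qed.

(** The positive part of f is the reflection of its negative part, and Lebesgue measure is invariant
    under reflection. *)
Lemma Rintegral_odd (f : R -> R) : measurable_fun setT f ->
  (forall x, f (- x) = - f x) -> \int[leb]_x f x = 0.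
Proof.
move=> mf fN; rewrite /Rintegral integralE.
rewrite [X in (X - _)%E](_ : _ = \int[leb]_x ((EFin \o f)^\- x)%E)%E.
  (* An infinite integral gives an infinite difference, which [fine] sends to 0. *)
  case: (\int[leb]_x _)%E => [r| |]//.
  by rewrite -EFinB subrr.
transitivity (\int[pushforward leb (-%R : R -> measurableTypeR R)]_x
    ((EFin \o f)^\+ x)%E)%E.
  by apply: eq_measure_integral => A mA _; rewrite /= lebesgue_measureN.
rewrite ge0_integral_pushforward//; last first.
  by apply: measurable_funepos; exact/measurable_EFinP.
apply: eq_integral => x _.
by rewrite /= funeposE funenegE /= fN EFinN.
Qed.

Lemma Rintegral_laplace_sin a b :
  \int[leb]_x (laplace a x * sin (b * x)) = 0.
Proof.
apply: Rintegral_odd.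
  by apply: measurable_funM; [exact: measurable_laplace|exact: measurable_sinM].
by move=> x; rewrite laplaceN mulrN sinN mulrN.
Qed.

(** The Poisson kernel of the upper half-plane at height e, that is, the Cauchy density of scale
    e. *)
Definition poisson (e x : R) := e / (pi * (e ^+ 2 + x ^+ 2)).

Lemma poisson_ge0 e x : 0 <= e -> 0 <= poisson e x.
Proof. by move=> e0; rewrite divr_ge0// mulr_ge0 ?pi_ge0// addr_ge0 ?sqr_ge0. Qed.

Lemma poissonN e x : poisson e (- x) = poisson e x.
Proof. by rewrite /poisson sqrrN. Qed.

Lemma continuous_poisson e : 0 < e -> continuous (poisson e).
Proof.
move=> e0 x; apply: cvgMl_tmp; apply: cvgV.
  by rewrite mulf_neq0 ?gt_eqF ?pi_gt0// ltr_wpDr ?sqr_ge0// exprn_gt0.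
apply: cvgMl_tmp; apply: cvgD; first exact: cvg_cst.
exact: exprn_continuous.
Qed.

Lemma integral_poisson e : 0 < e -> (\int[leb]_x (poisson e x)%:E = 1)%E.
Proof.
move=> e0; have e_neq0 : e != 0 by rewrite gt_eqF.
have pi_neq0 : (pi : R) != 0 by rewrite gt_eqF ?pi_gt0.
have ex_neq0 x : e ^+ 2 + x ^+ 2 != 0.
  by rewrite gt_eqF// ltr_wpDr ?sqr_ge0// exprn_gt0.
rewrite ge0_symfun_integralT; last 3 first.
- by move=> x; rewrite poisson_ge0// ltW.
- exact: continuous_poisson.
- by move=> x; rewrite /= poissonN.
rewrite -set_itvcy.
pose F (x : R) := pi^-1 * atan (e^-1 * x).
have dF (x : R) : is_derive x (1 : R) F (poisson e x).
  apply: trigger_derive; rewrite /GRing.scale/= /poisson.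
  move: pi pi_neq0 (ex_neq0 x) => p p0 ex0.
  have -> : 1 + (e^-1 * x) ^+ 2 = (e ^+ 2 + x ^+ 2) / e ^+ 2 by field.
  by field; rewrite p0 e_neq0 ex0.
have cF x : {for x, continuous F}.
  by apply/differentiable_continuous/derivable1_diffP; exact: ex_derive.
rewrite (@ge0_continuous_FTC2y _ _ F 0 (pi^-1 * (pi / 2))).
- rewrite [F 0]/F mulr0 atan0 mulr0 sube0 -EFinM; congr EFin.
  by move: pi pi_neq0 => p p0; field.
- by move=> x _; rewrite poisson_ge0// ltW.
- by apply: continuous_subspaceT => x; exact: continuous_poisson.
- apply: cvgMl_tmp.
  apply: (cvg_comp (fun x => e^-1 * x) atan); last exact: cvgy_atan.
  by apply: gt0_cvgMry; rewrite ?invr_gt0//; exact: cvg_id.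
- by move=> x _; exact: ex_derive.
- by have := cF 0; exact: cvg_at_right_filter.
- by move=> x _; rewrite derive1E; exact: derive_val.
Qed.

(** The left-hand side is the value of [Rintegral_laplace_cos] at rate 2 pi e and frequency 2 pi b:
    with the phase 2 pi x b, the transform of e^{- 2 pi e |x|} is [poisson e]. *)
Lemma poissonE e b : 0 < e ->
  2 * (2 * pi * e) / ((2 * pi * e) ^+ 2 + (2 * pi * b) ^+ 2) = poisson e b.
Proof.
move=> e0; rewrite /poisson.
have pi_neq0 : (pi : R) != 0 by rewrite gt_eqF ?pi_gt0.
have ex_neq0 : e ^+ 2 + b ^+ 2 != 0.
  by rewrite gt_eqF// ltr_wpDr ?sqr_ge0// exprn_gt0.
move: pi pi_neq0 => p p0.
have -> : (2 * p * e) ^+ 2 + (2 * p * b) ^+ 2 = 2 * p * (2 * p) * (e ^+ 2 + b ^+ 2).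
  by ring.
by field; rewrite p0 ex_neq0.
Qed.

End laplace.

(** * Integration on R^n *)

Section product_integrals.
Context d1 d2 (T1 : measurableType d1) (T2 : measurableType d2) (R : realType).
Variable m1 : {sigma_finite_measure set T1 -> \bar R}.
Variable m2 : {sigma_finite_measure set T2 -> \bar R}.

Lemma integrable_prodM (p : T1 -> R) (q : T2 -> R) :
  m1.-integrable setT (EFin \o p) -> m2.-integrable setT (EFin \o q) ->
  (m1 \x m2)%E.-integrable setT (EFin \o (fun z => p z.1 * q z.2)).
Proof.
move=> ip iq.
have mp : measurable_fun setT p by apply/measurable_EFinP; exact: measurable_int ip.
have mq : measurable_fun setT q by apply/measurable_EFinP; exact: measurable_int iq.
apply/integrable12ltyP.
  apply/measurable_EFinP; apply: measurable_funM.
    exact: measurableT_comp mp _.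
  exact: measurableT_comp mq _.
have mabsq : measurable_fun setT (fun y => `|q y|%:E).
  by apply/measurable_EFinP; exact: measurableT_comp.
rewrite (eq_integral (fun x => `|p x|%:E * \int[m2]_y `|q y|%:E)%E); last first.
  move=> x _; rewrite -ge0_integralZl//; apply: eq_integral => y _.
  by rewrite /= normrM EFinM.
have /integrableP[_ /= q_lty] := iq; have /integrableP[_ /= p_lty] := ip.
rewrite ge0_integralZr//; last 2 first.
- by apply/measurable_EFinP; exact: measurableT_comp.
- exact: integral_ge0.
apply: lte_mul_pinfty => //; first exact: integral_ge0.
by rewrite ge0_fin_numE//; exact: integral_ge0.
Qed.

(** The integrability of every slice, not just almost every one, lets the inner [fine] be undone
    pointwise. *)
Lemma RFubini (f : T1 * T2 -> R) :
  (m1 \x m2)%E.-integrable setT (EFin \o f) ->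
  (forall x, m2.-integrable setT (fun y => (f (x, y))%:E)) ->
  (forall y, m1.-integrable setT (fun x => (f (x, y))%:E)) ->
  \int[m1]_x \int[m2]_y f (x, y) = \int[m2]_y \int[m1]_x f (x, y).
Proof.
move=> fi f1 f2; rewrite /Rintegral; congr fine.
transitivity (\int[m1]_x \int[m2]_y (f (x, y))%:E)%E.
  by apply: eq_integral => x _; rewrite fineK//; exact: integrable_fin_num.
transitivity (\int[m2]_y \int[m1]_x (f (x, y))%:E)%E; first exact: Fubini fi.
by apply: eq_integral => y _; rewrite fineK//; exact: integrable_fin_num.
Qed.

(** The exchange behind the multiplication formula for Fourier transforms, u being a trigonometric
    kernel; the integrand is dominated by B |p| |q|. *)
Lemma RFubini_bounded_kernel (p : T1 -> R) (q : T2 -> R) (u : T1 * T2 -> R) B :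
  m1.-integrable setT (EFin \o p) -> m2.-integrable setT (EFin \o q) ->
  measurable_fun setT u -> (forall z, `|u z| <= B) ->
  \int[m1]_x (p x * \int[m2]_y (q y * u (x, y))) =
  \int[m2]_y (q y * \int[m1]_x (p x * u (x, y))).
Proof.
move=> ip iq mu uB.
have q1 x : m2.-integrable setT (EFin \o (fun y => q y * u (x, y))).
  apply: (integrableMbounded iq _ (fun y => uB (x, y))).
  exact: measurableT_comp mu (measurable_pair1 _).
have p1 y : m1.-integrable setT (EFin \o (fun x => p x * u (x, y))).
  apply: (integrableMbounded ip _ (fun x => uB (x, y))).
  exact: measurableT_comp mu (measurable_pair2 _).
transitivity (\int[m1]_x \int[m2]_y (p x * q y * u (x, y))).
  apply: eq_Rintegral => x _; rewrite -RintegralZl//.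
  by apply: eq_Rintegral => y _; rewrite mulrA.
rewrite (@RFubini (fun z => p z.1 * q z.2 * u z)); first last.
- move=> y; apply: eq_integrable (integrableZl _ (q y) (p1 y)) => // x _.
  by rewrite /= -EFinM mulrCA mulrA.
- move=> x; apply: eq_integrable (integrableZl _ (p x) (q1 x)) => // y _.
  by rewrite /= -EFinM mulrA.
- exact: integrableMbounded (integrable_prodM ip iq) mu uB.
apply: eq_Rintegral => y _; rewrite -RintegralZl//.
by apply: eq_Rintegral => x _; rewrite /= mulrCA mulrA.
Qed.

(** Tonelli yields measurability for nonnegative integrands, hence the splitting into positive and
    negative parts. *)
Lemma measurable_fun_Rintegral (f : T1 * T2 -> R) :
  measurable_fun setT f -> measurable_fun setT (fun x => \int[m2]_y f (x, y)).
Proof.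
move=> mf; rewrite /Rintegral; apply: measurableT_comp => //=.
have mEf : measurable_fun setT (EFin \o f) by exact/measurable_EFinP.
rewrite [X in measurable_fun _ X](_ : _ = (fun x =>
    \int[m2]_y (EFin \o f)^\+ (x, y) - \int[m2]_y (EFin \o f)^\- (x, y))%E).
  apply: emeasurable_funB.
    apply: (@measurable_fun_fubini_tonelli_F _ _ _ _ _ m2 (EFin \o f)^\+%E) => //.
    exact: measurable_funepos.
  apply: (@measurable_fun_fubini_tonelli_F _ _ _ _ _ m2 (EFin \o f)^\-%E) => //.
  exact: measurable_funeneg.
apply/funext => x; rewrite integralE; congr (_ - _)%E; apply: eq_integral => y _.
  by rewrite !funeposE.
by rewrite !funenegE.
Qed.

End product_integrals.

Section lebesgue_cV_integrals.
Variable R : realType.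
Local Notation leb := (@lebesgue_measure R).
Local Notation lcV := (@lebesgue_cV R).

Lemma cons_cV0 n (p : R * 'cV[R]_n) j : cons_cV p ord0 j = p.1.
Proof. by rewrite ord1 -[in RHS](headtailK p). Qed.

Lemma cons_cVS n (p : R * 'cV[R]_n) (i : 'I_n) j :
  cons_cV p (lift ord0 i) j = p.2 i 0.
Proof.
have -> : lift ord0 i = rshift 1 i by exact/val_inj.
by rewrite ord1 -[in RHS](headtailK p) /= [RHS]mxE.
Qed.

Lemma ge0_integral_lebesgue_cVS n (f : 'cV[R]_n.+1 -> \bar R) :
  measurable_fun setT f -> (forall v, 0 <= f v)%E ->
  (\int[lcV n.+1]_v f v = \int[leb]_x \int[lcV n]_w f (cons_cV (x, w)))%E.
Proof.
move=> mf f0; transitivity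
  (\int[pushforward (leb \x lcV n)%E (@cons_cV R n)]_v f v)%E => //.
rewrite ge0_integral_pushforward//; last exact: measurable_cons_cV.
rewrite preimage_setT fubini_tonelli1//.
  exact: measurableT_comp mf (@measurable_cons_cV R n).
by move=> x; exact: f0.
Qed.

Lemma ge0_integral_lebesgue_cV_prod n (h : 'I_n -> R -> R) :
  (forall i, measurable_fun setT (h i)) -> (forall i x, 0 <= h i x) ->
  (\int[lcV n]_v (\prod_i h i (v i 0))%:E =
   \prod_i \int[leb]_x (h i x)%:E)%E.
Proof.
elim: n h => [|n IH] h mh h0.
  rewrite big_ord0; under eq_integral do rewrite big_ord0.
  by rewrite integral_cst// mul1e /= diracE in_setT.
rewrite ge0_integral_lebesgue_cVS; last 2 first.
- apply/measurable_EFinP; apply: measurable_prod => i _.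
  exact: measurableT_comp (mh i) (@measurable_coord_mx R _ _ i 0).
- by move=> v; rewrite lee_fin prodr_ge0.
rewrite big_ord_recl -IH//.
rewrite -ge0_integralZr//; last 3 first.
- by apply/measurable_EFinP; exact: mh.
- by move=> x _; rewrite lee_fin.
- by apply: integral_ge0 => v _; rewrite lee_fin prodr_ge0.
apply: eq_integral => x _; rewrite -ge0_integralZl//; last 3 first.
- apply/measurable_EFinP; apply: measurable_prod => i _.
  exact: measurableT_comp (mh _) (@measurable_coord_mx R _ _ i 0).
- by move=> v _; rewrite lee_fin prodr_ge0.
- by rewrite lee_fin.
apply: eq_integral => w _; rewrite -EFinM big_ord_recl.
rewrite cons_cV0; congr (_ * _)%:E; apply: eq_bigr => i _; congr (h _ _).
exact: (cons_cVS (x, w)).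
Qed.

(** Serves inductions on the dimension: F separates into a function of the first coordinate and a
    function of the others. *)
Lemma Rintegral_lebesgue_cVS_prod n (f : R -> R) (h : 'cV[R]_n -> R)
    (F : 'cV[R]_n.+1 -> R) :
  leb.-integrable setT (EFin \o f) -> (lcV n).-integrable setT (EFin \o h) ->
  measurable_fun setT F -> (forall p, F (cons_cV p) = f p.1 * h p.2) ->
  (lcV n.+1).-integrable setT (EFin \o F) /\
  \int[lcV n.+1]_v F v = \int[leb]_x f x * \int[lcV n]_w h w.
Proof.
move=> fi hi mF Fcons.
have mEF : measurable_fun setT (EFin \o F) by exact/measurable_EFinP.
have iF : (leb \x lcV n)%E.-integrable setT ((EFin \o F) \o @cons_cV R n).
  apply: eq_integrable (integrable_prodM fi hi) => // p _.
  by rewrite /= Fcons.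
split; first by apply: integrable_pushforward => //; exact: measurable_cons_cV.
rewrite {1}/Rintegral; transitivity
  (fine (\int[pushforward (leb \x lcV n)%E (@cons_cV R n)]_v (F v)%:E)%E) => //.
rewrite integral_pushforward//; last exact: measurable_cons_cV.
rewrite preimage_setT -integral12_prod_meas1// /fubini_F.
have -> : (\int[leb]_x \int[lcV n]_y ((EFin \o F) \o @cons_cV R n) (x, y))%E =
    (\int[leb]_x ((f x)%:E * (\int[lcV n]_w h w)%:E))%E.
  apply: eq_integral => x _; rewrite fineK; last exact: integrable_fin_num.
  by rewrite -integralZl//; apply: eq_integral => w _; rewrite /= Fcons.
rewrite integralZr// fineM//; exact: integrable_fin_num.
Qed.

End lebesgue_cV_integrals.

(** * Affine changes of variables on the line and on R^n *)

Section affine.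
Variable R : realType.
Local Notation leb := (@lebesgue_measure R).
Local Notation lcV := (@lebesgue_cV R).

Lemma continuous_measurable_mx m n m' n' (f : 'M[R]_(m, n) -> 'M[R]_(m', n')) :
  continuous f -> measurable_fun setT f.
Proof.
move=> /continuousP cf; apply: measurable_fun_mx => U oU.
by apply: open_measurable_mx; exact: cf.
Qed.

Lemma continuous_measurable_mxR m n (f : 'M[R]_(m, n) -> R) :
  continuous f -> measurable_fun setT f.
Proof.
move=> /continuousP cf; apply: (measurability _ (RGenOpens.measurableE R)).
move=> _ [_ [a [b ->]] <-]; rewrite setTI; apply: open_measurable_mx.
by apply: cf; exact: interval_open.
Qed.

(** The pushforward of Lebesgue measure by x |-> a + e x, multiplied by e, agrees with Lebesgue
    measure on half-open intervals, hence everywhere by uniqueness. *)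
Lemma ge0_integral_affine (a e : R) (f : R -> \bar R) : 0 < e ->
  measurable_fun setT f -> (forall x, 0 <= f x)%E ->
  (\int[leb]_x f x = e%:E * \int[leb]_x f (a + e * x)%R)%E.
Proof.
move=> e0 mf f0.
have maff : measurable_fun setT
    (fun x : measurableTypeR R => a + e * x : measurableTypeR R).
  by apply: measurable_funD => //; exact: measurable_funM.
pose m : {measure set (measurableTypeR R) -> \bar R} :=
  measure_function_pushforward__canonical__measure_function_Measure leb maff.
transitivity (\int[mscale (NngNum (ltW e0)) m]_x f x)%E.
  apply: eq_measure_integral => A mA _.
  apply: (@lebesgue_measure_unique R (mscale (NngNum (ltW e0)) m)) mA.
  move=> _ [[b c] _ <-]; rewrite /mscale /m/= /pushforward.
  transitivity (e%:E * leb `]((b - a) / e)%R, ((c - a) / e)%R]%classic)%E; last first.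
    rewrite /mscale /= /pushforward; congr (_ * leb _)%E.
    apply/seteqP; split=> x /=; rewrite !in_itv/=.
      by rewrite ltr_pdivrMr// ler_pdivlMr// mulrC; lra.
    by rewrite ltr_pdivrMr// ler_pdivlMr// mulrC; lra.
  rewrite [in LHS]lebesgue_measure_itv [in RHS]lebesgue_measure_itv/= !lte_fin.
  rewrite ltr_pM2r ?invr_gt0// ltrD2r; case: ifPn => _; last by rewrite mule0.
  have e_neq0 : e != 0 by rewrite gt_eqF.
  by rewrite -!EFinB -EFinM; congr EFin; field.
rewrite ge0_integral_mscale//= ge0_integral_pushforward//.
Qed.

Lemma cvg_mx (T : Type) (F : set_system T) (FF : Filter F) m n
    (f : T -> 'M[R]_(m, n)) (l : 'M[R]_(m, n)) :
  (forall i j, f x i j @[x --> F] --> l i j) -> f @ F --> l.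
Proof.
move=> fl U [P lP PU]; apply: (@filterS _ F _
  [set x | forall i j, P i j (f x i j)]).
  by move=> x /= Px; apply: PU.
apply: filter_forall => i; apply: filter_forall => j.
exact: fl (lP i j).
Qed.

Lemma continuous_affine_mx m n (a : 'M[R]_(m, n)) (e : R) :
  continuous (fun v : 'M[R]_(m, n) => a + e *: v : 'M[R]_(m, n)).
Proof.
move=> v; apply: (@cvg_mx _ (nbhs v)) => i j.
under eq_cvg do rewrite !mxE; rewrite !mxE.
apply: cvgD; first exact: cvg_cst.
by apply: cvgMl_tmp; exact: coord_continuous.
Qed.

(** Each coordinate contributes one factor e. The case e = 1 gives translations; the general case
    rescales the Poisson kernel around a point. *)
Lemma ge0_integral_lebesgue_cV_affine n (a : 'cV[R]_n) (e : R)
    (f : 'cV[R]_n -> \bar R) : 0 < e ->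
  measurable_fun setT f -> (forall x, 0 <= f x)%E ->
  (\int[lcV n]_v f v = (e ^+ n)%:E * \int[lcV n]_v f (a + e *: v)%R)%E.
Proof.
move=> e0; elim: n a f => [|n IH] a f mf f0.
  rewrite expr0 mul1e; apply: eq_integral => v _; congr f.
  by apply/matrixP => -[].
rewrite ge0_integral_lebesgue_cVS//.
rewrite ge0_integral_lebesgue_cVS; last 2 first.
- apply: measurableT_comp mf _; apply: continuous_measurable_mx.
  exact: continuous_affine_mx.
- by move=> v; exact: f0.
have mcons : measurable_fun setT (fun p : R * 'cV[R]_n => f (cons_cV p)).
  exact: measurableT_comp mf (@measurable_cons_cV R n).
have aff_cons x w : a + e *: cons_cV (x, w) =
    cons_cV (a ord0 0 + e * x, tail_cV a + e *: w).
  apply/matrixP => i j; rewrite [LHS]mxE [X in _ + X]mxE !ord1.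
  case: (unliftP ord0 i) => [k|] ->; last by rewrite !cons_cV0.
  rewrite (cons_cVS (x, w)) (cons_cVS (_, _)) /= !mxE.
  by congr (a _ _ + _); exact/val_inj.
under [in RHS]eq_integral do under eq_integral do rewrite aff_cons.
pose g x := (\int[lcV n]_w f (cons_cV (x, w)))%E.
have mg : measurable_fun setT g.
  exact: (@measurable_fun_fubini_tonelli_F _ _ _ _ R (lcV n) _ mcons).
have g0 x : (0 <= g x)%E by exact: integral_ge0.
transitivity (\int[leb]_x g x)%E => //.
rewrite (ge0_integral_affine (a ord0 0) e0 mg g0).
rewrite exprS EFinM -muleA; congr (_ * _)%E.
rewrite -ge0_integralZl//; last 3 first.
- apply: (@measurable_fun_fubini_tonelli_F _ _ _ _ R (lcV n)
    (fun p => f (cons_cV (a ord0 0 + e * p.1, tail_cV a + e *: p.2)%R))).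
  move: mcons => /measurableT_comp; apply; apply: measurable_fun_pair => /=.
    by apply: measurable_funD => //; exact: measurable_funM.
  have := continuous_measurable_mx (@continuous_affine_mx n 1 (tail_cV a) e).
  by move=> /measurableT_comp; apply; exact: measurable_snd.
- by move=> p; exact: f0.
- by move=> x _; apply: integral_ge0 => w _; exact: f0.
- by rewrite lee_fin exprn_ge0// ltW.
apply: eq_integral => x _; rewrite /g (IH (tail_cV a))//.
exact: measurableT_comp mcons (measurable_pair1 _).
Qed.

End affine.

(** * The product Laplace and Poisson kernels *)

Section kernels.
Variable R : realType.
Variable n : nat.
Implicit Types (e : R) (v xi eta : 'cV[R]_n).

(** The rate 2 pi e matches the 2 pi of the Fourier phase, so that the transform is exactly
    [poisson_cV e]. The decay is in the l^1 norm, which makes the kernel a product over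
    coordinates. *)
Definition laplace_cV e v := \prod_i laplace (2 * pi * e) (v i 0).
Definition poisson_cV e v := \prod_i poisson e (v i 0).

End kernels.

Section kernels_theory.
Variable R : realType.
Local Notation leb := (@lebesgue_measure R).
Local Notation lcV := (@lebesgue_cV R).

Lemma measurable_poisson e : 0 < e -> measurable_fun setT (@poisson R e).
Proof.
by move=> e0; apply: continuous_measurable_fun; exact: continuous_poisson.
Qed.

Section fixed_dimension.
Variable n : nat.
Implicit Types (e : R) (v xi eta : 'cV[R]_n).

Lemma laplace_cV_gt0 e v : 0 < laplace_cV e v.
Proof. by apply: prodr_gt0 => i _; exact: laplace_gt0. Qed.

Lemma laplace_cV_le1 e v : 0 <= e -> laplace_cV e v <= 1.
Proof.
move=> e0; apply: prodr_ile1 => i _.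
by rewrite ltW ?laplace_gt0//= laplace_le1// !mulr_ge0// pi_ge0.
Qed.

Lemma laplace_cVE e v :
  laplace_cV e v = expR (- (2 * pi * (\sum_i `|v i 0|) * e)).
Proof.
rewrite /laplace_cV /laplace -expR_sum sumrN; congr expR.
by rewrite -mulr_sumr mulrAC.
Qed.

Lemma le_laplace_cV e e' v : e <= e' -> laplace_cV e' v <= laplace_cV e v.
Proof.
move=> ee'; rewrite !laplace_cVE ler_expR lerN2 ler_wpM2l//.
by rewrite !mulr_ge0// ?pi_ge0// sumr_ge0.
Qed.

Lemma cvg_laplace_cV (e_ : nat -> R) v : e_ @ \oo --> 0 ->
  laplace_cV (e_ k) v @[k --> \oo] --> (1 : R).
Proof.
move=> e_cvg; have h : - (2 * pi * (\sum_i `|v i 0|) * e_ k) @[k --> \oo] --> (0 : R).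
  rewrite -[X in _ --> X]oppr0; apply: cvgN.
  by rewrite -[X in _ --> X](mulr0 (2 * pi * \sum_i `|v i 0|)); exact: cvgMl_tmp.
have : expR (- (2 * pi * (\sum_i `|v i 0|) * e_ k)) @[k --> \oo] --> expR (0 : R).
  by apply: continuous_cvg; [exact: continuous_expR|exact: h].
rewrite expR0.
rewrite (_ : (fun k => laplace_cV (e_ k) v) =
    fun k => expR (- (2 * pi * (\sum_i `|v i 0|) * e_ k)))//.
by apply/funext => k; rewrite /= laplace_cVE.
Qed.

Lemma measurable_laplace_cV e : measurable_fun setT (laplace_cV e : 'cV[R]_n -> R).
Proof.
apply: measurable_prod => i _.
exact: measurableT_comp (measurable_laplace _) (@measurable_coord_mx R _ _ i 0).
Qed.

Lemma poisson_cV_ge0 e v : 0 <= e -> 0 <= poisson_cV e v.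
Proof. by move=> e0; apply: prodr_ge0 => i _; exact: poisson_ge0. Qed.

Lemma poisson_cVN e v : poisson_cV e (- v) = poisson_cV e v.
Proof. by apply: eq_bigr => i _; rewrite mxE poissonN. Qed.

Lemma measurable_poisson_cV e : 0 < e ->
  measurable_fun setT (poisson_cV e : 'cV[R]_n -> R).
Proof.
move=> e0; apply: measurable_prod => i _.
exact: measurableT_comp (measurable_poisson e0) (@measurable_coord_mx R _ _ i 0).
Qed.

Lemma integral_poisson_cV e : 0 < e ->
  (\int[lcV n]_v (poisson_cV e v)%:E = 1)%E.
Proof.
move=> e0; rewrite (@ge0_integral_lebesgue_cV_prod R n (fun=> poisson e)); last 2 first.
- by move=> i; exact: measurable_poisson.
- by move=> i x; apply: poisson_ge0; exact: ltW.
by rewrite big1// => i _; exact: integral_poisson.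
Qed.

(** Moves the parameter from the kernel to the argument of the function being smoothed, so that the
    kernel is fixed when e tends to 0. *)
Lemma poisson_cVZ e v : 0 < e -> e ^+ n * poisson_cV e (e *: v) = poisson_cV 1 v.
Proof.
move=> e0; rewrite -[n in e ^+ n]card_ord -prodr_const -big_split.
apply: eq_bigr => i _; rewrite /= mxE /poisson.
have pi_neq0 : (pi : R) != 0 by rewrite gt_eqF ?pi_gt0.
have v_neq0 : 1 + v i 0 ^+ 2 != 0 by rewrite gt_eqF// ltr_wpDr ?sqr_ge0.
have -> : e ^+ 2 + (e * v i 0) ^+ 2 = e ^+ 2 * (1 + v i 0 ^+ 2) by ring.
rewrite expr1n; move: pi pi_neq0 => p p0.
by field; rewrite p0 v_neq0 gt_eqF.
Qed.

Lemma dot_cVE (x y : 'cV[R]_n) : dot_cV x y = \sum_i x i 0 * y i 0.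
Proof. by rewrite /dot_cV mxE; under eq_bigr do rewrite mxE. Qed.

Lemma measurable_dot_cV d (U : measurableType d)
    (f g : U -> 'cV[R]_n) :
  measurable_fun setT f -> measurable_fun setT g ->
  measurable_fun setT (fun x => dot_cV (f x) (g x)).
Proof.
move=> mf mg; rewrite [X in measurable_fun _ X](_ : _ =
    (fun x => \sum_i f x i 0 * g x i 0)); last first.
  by apply/funext => x; rewrite dot_cVE.
apply: measurable_sum => i; apply: measurable_funM.
  exact: measurableT_comp (@measurable_coord_mx R _ _ i 0) mf.
exact: measurableT_comp (@measurable_coord_mx R _ _ i 0) mg.
Qed.

End fixed_dimension.

(** Induction on n, starting from the Dirac mass on a point. The addition formulas split each
    integrand into two separated products, and those containing a sine integral on the line or in
    dimension n vanish. Integrability is part of the induction because the product rule for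
    integrals asks for it. *)
Lemma laplace_cV_fourier n e : 0 < e ->
  (lcV n).-integrable setT (EFin \o laplace_cV e) /\
  forall eta : 'cV[R]_n,
  \int[lcV n]_v (laplace_cV e v * cos (2 * pi * dot_cV v eta)) = poisson_cV e eta /\
  \int[lcV n]_v (laplace_cV e v * sin (2 * pi * dot_cV v eta)) = 0.
Proof.
move=> e0; have pe0 : 0 < 2 * pi * e by rewrite !mulr_gt0// pi_gt0.
elim: n => [|n [iL IH]].
  have L1 (v : 'cV[R]_0) : laplace_cV e v = 1 by rewrite /laplace_cV big_ord0.
  have dot0 (v eta : 'cV[R]_0) : dot_cV v eta = 0 by rewrite /dot_cV mxE big_ord0.
  have I1 : (\int[lcV 0]_v 1%:E = 1)%E.
    by rewrite integral_cst// mul1e /= diracE in_setT.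
  split.
    apply/integrableP; split.
      by apply/measurable_EFinP; exact: measurable_laplace_cV.
    under eq_integral do rewrite /= L1 normr1.
    by rewrite I1 ltry.
  move=> eta; split.
    under eq_Rintegral do rewrite L1 dot0 mulr0 cos0 mulr1.
    by rewrite /Rintegral I1 /poisson_cV big_ord0.
  under eq_Rintegral do rewrite L1 dot0 mulr0 sin0 mulr0.
  by rewrite Rintegral_cst// mul0r.
have Lcons p : laplace_cV e (cons_cV p : 'cV[R]_n.+1) =
    laplace (2 * pi * e) p.1 * laplace_cV e p.2.
  rewrite /laplace_cV big_ord_recl cons_cV0.
  by congr (_ * _); apply: eq_bigr => i _; rewrite cons_cVS.
have dotcons p (eta : 'cV[R]_n.+1) : dot_cV (cons_cV p) eta =
    eta ord0 0 * p.1 + dot_cV p.2 (tail_cV eta).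
  rewrite !dot_cVE big_ord_recl cons_cV0 mulrC; congr (_ + _).
  apply: eq_bigr => i _; rewrite cons_cVS mxE; congr (_ * eta _ _).
  exact/val_inj.
have mc (eta : 'cV[R]_n) : measurable_fun setT (fun v => cos (2 * pi * dot_cV v eta)).
  apply: measurableT_comp (measurable_cosM _) _.
  exact: (@measurable_dot_cV n _ _ id (cst eta)).
have ms (eta : 'cV[R]_n) : measurable_fun setT (fun v => sin (2 * pi * dot_cV v eta)).
  apply: measurableT_comp (measurable_sinM _) _.
  exact: (@measurable_dot_cV n _ _ id (cst eta)).
split; first by have [] := Rintegral_lebesgue_cVS_prod (integrable_laplace pe0) iL
    (measurable_laplace_cV _) Lcons.
move=> eta; pose eta' := tail_cV eta; have [IHc IHs] := IH eta'.
pose b := 2 * pi * eta ord0 0.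
have mL := @measurable_laplace_cV n.+1 e.
have mtail := @measurable_tail_cV R n.
have mhead := @measurable_coord_mx R n.+1 1 ord0 0.
have iLc : (lcV n).-integrable setT
    (EFin \o (fun v => laplace_cV e v * cos (2 * pi * dot_cV v eta'))).
  by apply: (integrableMbounded iL _ (B := 1)) => // v; exact: norm_cos_le1.
have iLs : (lcV n).-integrable setT
    (EFin \o (fun v => laplace_cV e v * sin (2 * pi * dot_cV v eta'))).
  by apply: (integrableMbounded iL _ (B := 1)) => // v; exact: norm_sin_le1.
(* Used for the four products of a cosine or sine of the first coordinate with a cosine or sine of
   the others. *)
have H (f : R -> R) (h : 'cV[R]_n -> R) : measurable_fun setT f ->
    measurable_fun setT h ->
    leb.-integrable setT (EFin \o (fun x => laplace (2 * pi * e) x * f x)) ->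
    (lcV n).-integrable setT (EFin \o (fun v => laplace_cV e v * h v)) ->
    (lcV n.+1).-integrable setT
      (EFin \o (fun v => laplace_cV e v * (f (v ord0 0) * h (tail_cV v)))) /\
    \int[lcV n.+1]_v (laplace_cV e v * (f (v ord0 0) * h (tail_cV v))) =
    (\int[leb]_x (laplace (2 * pi * e) x * f x)) *
    (\int[lcV n]_v (laplace_cV e v * h v)).
  move=> mf mh fi hi; apply: Rintegral_lebesgue_cVS_prod => //.
    apply: measurable_funM => //; apply: measurable_funM.
      exact: measurableT_comp mf mhead.
    exact: measurableT_comp mh mtail.
  move=> [x w]; rewrite Lcons cons_cV0; have [_ ->] := headtailK (x, w).
  by rewrite /=; ring.
have [icc Icc] := H _ _ (measurable_cosM b) (mc eta') (integrable_laplace_cos b pe0) iLc.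
have [iss Iss] := H _ _ (measurable_sinM b) (ms eta') (integrable_laplace_sin b pe0) iLs.
have [ics Ics] := H _ _ (measurable_cosM b) (ms eta') (integrable_laplace_cos b pe0) iLs.
have [isc Isc] := H _ _ (measurable_sinM b) (mc eta') (integrable_laplace_sin b pe0) iLc.
have dotE v : 2 * pi * dot_cV v eta =
    b * v ord0 0 + 2 * pi * dot_cV (tail_cV v) eta'.
  rewrite /b !dot_cVE big_ord_recl mulrDr; congr (_ + _); first by ring.
  congr (_ * _); apply: eq_bigr => i _; rewrite !mxE.
  by congr (v _ _ * eta _ _); exact/val_inj.
split.
  under eq_Rintegral do rewrite dotE cosD mulrBr.
  rewrite RintegralB// Icc Iss Rintegral_laplace_sin mul0r subr0 IHc.
  rewrite Rintegral_laplace_cos// poissonE// /poisson_cV big_ord_recl.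
  congr (_ * _); apply: eq_bigr => i _; rewrite mxE; congr (poisson _ (eta _ _)).
  exact/val_inj.
under eq_Rintegral do rewrite dotE sinD mulrDr.
by rewrite RintegralD// Isc Ics Rintegral_laplace_sin mul0r add0r IHs mulr0.
Qed.

End kernels_theory.

(** * Inverse Fourier transform of an integrable continuous function *)

Section L2_criteria.
Variables (R : realType) (n : nat).
Local Notation mu := (@lebesgue_cV R n).
Implicit Types f h : 'cV[R]_n -> R[i].

Lemma normc_ge0 (z : R[i]) : 0 <= Normc.normc z.
Proof. by case: z => a b; exact: sqrtr_ge0. Qed.

Lemma sqr_normcE (z : R[i]) :
  Normc.normc z ^+ 2 = complex.Re z ^+ 2 + complex.Im z ^+ 2.
Proof. by case: z => a b; rewrite sqr_sqrtr// addr_ge0 ?sqr_ge0. Qed.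

Lemma normcE (z : R[i]) :
  Normc.normc z = Num.sqrt (complex.Re z ^+ 2 + complex.Im z ^+ 2).
Proof. by case: z. Qed.

Lemma normc_le (z : R[i]) :
  Normc.normc z <= `|complex.Re z| + `|complex.Im z|.
Proof.
rewrite normcE -[leRHS]ger0_norm ?addr_ge0// -sqrtr_sqr ler_wsqrtr//.
by rewrite sqrrD !real_normK ?num_real// addrAC lerDl mulrn_wge0// mulr_ge0.
Qed.

Lemma measurable_normc h : measurable_funC h ->
  measurable_fun setT (fun x => Normc.normc (h x)).
Proof.
move=> [mRe mIm].
rewrite [X in measurable_fun _ X](_ : _ = (fun y : R => Num.sqrt y) \o
  (fun x => complex.Re (h x) ^+ 2 + complex.Im (h x) ^+ 2)); last first.
  by apply/funext => x; rewrite normcE.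
apply: measurableT_comp.
  by apply: continuous_measurable_fun; exact: sqrt_continuous.
by apply: measurable_funD; exact: measurable_funX.
Qed.

Lemma LfunC1_integrable h : measurable_funC h ->
  mu.-integrable setT (EFin \o (fun x => complex.Re (h x))) ->
  mu.-integrable setT (EFin \o (fun x => complex.Im (h x))) ->
  LfunC 1%:E h.
Proof.
move=> mh iRe iIm; split => //; rewrite /LnormC Lnorm1.
have iD := integrableD measurableT (integrable_norm iRe) (integrable_norm iIm).
have /integrableP[mD] := iD; apply: le_lt_trans; apply: ge0_le_integral => //.
- by apply: measurableT_comp => //; apply/measurable_EFinP; exact: measurable_normc.
- exact: measurableT_comp.
- move=> x _; rewrite /= lee_fin ger0_norm ?normc_ge0//.
  by rewrite ger0_norm ?addr_ge0// normc_le.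
Qed.

Lemma LnormC2E h : LnormC 2%:E h =
  poweR (\int[mu]_x (complex.Re (h x) ^+ 2 + complex.Im (h x) ^+ 2)%:E)%E 2^-1.
Proof.
rewrite /LnormC unlock; congr poweR; apply: eq_integral => x _.
rewrite gee0_abs ?lee_fin ?normc_ge0// poweR_EFin powR_mulrn ?normc_ge0//.
by rewrite sqr_normcE.
Qed.

Lemma LfunC2_integrable h : measurable_funC h ->
  mu.-integrable setT
    (EFin \o (fun x => complex.Re (h x) ^+ 2 + complex.Im (h x) ^+ 2)) ->
  LfunC 2%:E h.
Proof.
move=> mh ih; split=> //; rewrite LnormC2E.
have /integrable_fin_num/fineK <- // := ih.
by rewrite poweR_EFin ltry.
Qed.

Lemma cvgL2_integral (f_ : nat -> 'cV[R]_n -> R[i]) f :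
  (forall k, mu.-integrable setT (EFin \o
    (fun x => complex.Re (f_ k x - f x) ^+ 2 + complex.Im (f_ k x - f x) ^+ 2))) ->
  (\int[mu]_x (complex.Re (f_ k x - f x) ^+ 2 +
               complex.Im (f_ k x - f x) ^+ 2)%:E)%E @[k --> \oo] --> 0%E ->
  cvgL2 f_ f.
Proof.
move=> fi /fine_cvgP[_ fcvg]; rewrite /cvgL2.
under eq_cvg => k.
  rewrite LnormC2E -(fineK (integrable_fin_num measurableT (fi k))) poweR_EFin.
  over.
apply: cvg_EFin; first exact: nearW.
rewrite [X in X @ _ --> _](_ : _ = (fun k => Num.sqrt (fine (\int[mu]_x
    (complex.Re (f_ k x - f x) ^+ 2 + complex.Im (f_ k x - f x) ^+ 2)%:E)%E))).
  rewrite -[0]sqrtr0; apply: continuous_cvg; last exact: fcvg.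
  exact: sqrt_continuous.
apply/funext => k /=; rewrite powR12_sqrt// fine_ge0// integral_ge0// => x _.
by rewrite lee_fin addr_ge0 ?sqr_ge0.
Qed.

End L2_criteria.

(** * Abel summation of the inverse Fourier integral *)

Section inverse_fourier.
Variables (R : realType) (n : nat) (g : 'cV[R]_n -> R) (M : R).
Local Notation mu := (@lebesgue_cV R n).
Hypothesis cg : continuous g.
Hypothesis g0 : forall x, 0 <= g x.
Hypothesis gM : forall x, g x <= M.
Hypothesis ig : mu.-integrable setT (EFin \o g).
Implicit Types (x w xi : 'cV[R]_n) (e : R).

Let mg : measurable_fun setT g.
Proof. exact: continuous_measurable_mxR. Qed.

Let phase (p : 'cV[R]_n * 'cV[R]_n) := 2 * pi * dot_cV p.1 p.2.

Let mphase : measurable_fun setT phase.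
Proof.
apply: measurable_funM; first exact: measurable_cst.
by apply: measurable_dot_cV; [exact: measurable_fst|exact: measurable_snd].
Qed.

Let mcosphase : measurable_fun setT (fun p => cos (phase p)).
Proof.
apply: measurableT_comp mphase; apply: continuous_measurable_fun.
exact: continuous_cos.
Qed.

Let msinphase : measurable_fun setT (fun p => sin (phase p)).
Proof.
apply: measurableT_comp mphase; apply: continuous_measurable_fun.
exact: continuous_sin.
Qed.

Let cosT x := \int[mu]_w (g w * cos (phase (x, w))).
Let sinT x := \int[mu]_w (g w * sin (phase (x, w))).
Let I := \int[mu]_w g w.

Let icos x : mu.-integrable setT (EFin \o (fun w => g w * cos (phase (x, w)))).
Proof.
apply: (integrableMbounded ig _ (B := 1)); last by move=> w; exact: norm_cos_le1.
exact: measurableT_comp mcosphase (measurable_pair1 x).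
Qed.

Let isin x : mu.-integrable setT (EFin \o (fun w => g w * sin (phase (x, w)))).
Proof.
apply: (integrableMbounded ig _ (B := 1)); last by move=> w; exact: norm_sin_le1.
exact: measurableT_comp msinphase (measurable_pair1 x).
Qed.

Let cosT_le x : `|cosT x| <= I.
Proof.
apply: le_trans (le_normr_Rintegral _ (icos x)) _ => //.
apply: le_Rintegral => //; first exact: integrable_norm.
move=> w _; rewrite normrM (ger0_norm (g0 w)) ler_piMr//.
exact: norm_cos_le1.
Qed.

Let sinT_le x : `|sinT x| <= I.
Proof.
apply: le_trans (le_normr_Rintegral _ (isin x)) _ => //.
apply: le_Rintegral => //; first exact: integrable_norm.
move=> w _; rewrite normrM (ger0_norm (g0 w)) ler_piMr//.
exact: norm_sin_le1.
Qed.

Let mcosT : measurable_fun setT cosT.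
Proof.
apply: (@measurable_fun_Rintegral _ _ _ _ _ mu (fun p => g p.2 * cos (phase p))).
apply: measurable_funM => //; exact: measurableT_comp mg measurable_snd.
Qed.

Let msinT : measurable_fun setT sinT.
Proof.
apply: (@measurable_fun_Rintegral _ _ _ _ _ mu (fun p => g p.2 * sin (phase p))).
apply: measurable_funM => //; exact: measurableT_comp mg measurable_snd.
Qed.

Let smooth e xi := \int[mu]_w (g w * poisson_cV e (w - xi)).

Let phaseB x w xi : phase (x, w - xi) = phase (x, w) - phase (x, xi).
Proof. by rewrite /phase /= /dot_cV mulmxBr !mxE mulrBr. Qed.

Let msub xi : measurable_fun setT (fun w => w - xi).
Proof.
have := continuous_measurable_mx (@continuous_affine_mx R n 1 (- xi) 1).
by congr measurable_fun; apply/funext => w; rewrite scale1r addrC.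
Qed.

Let mshift xi : measurable_fun setT (fun p : 'cV[R]_n * 'cV[R]_n => (p.1, p.2 - xi)).
Proof.
apply: measurable_fun_pair; first exact: measurable_fst.
exact: measurableT_comp (msub xi) measurable_snd.
Qed.

(** The bracket is the integral over w of g w times the cosine of the phase at w - xi. Integrating
    in x before w replaces this cosine by its integral against [laplace_cV e], which is the Poisson
    kernel at w - xi. *)
Let smooth_cos e xi : 0 < e ->
  \int[mu]_x (laplace_cV e x *
    (cosT x * cos (phase (x, xi)) + sinT x * sin (phase (x, xi)))) = smooth e xi.
Proof.
move=> e0; have [iL FL] := @laplace_cV_fourier R n e e0.
transitivity (\int[mu]_x (laplace_cV e x *
    \int[mu]_w (g w * cos (phase (x, w - xi))))).
  apply: eq_Rintegral => x _; congr (_ * _).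
  rewrite -!RintegralZr// -RintegralD//; last 2 first.
  - exact: integrableZr (icos x).
  - exact: integrableZr (isin x).
  by apply: eq_Rintegral => w _; rewrite phaseB cosB; ring.
rewrite (@RFubini_bounded_kernel _ _ _ _ _ mu mu _ _
  (fun p => cos (phase (p.1, p.2 - xi))) 1)//; last 2 first.
- exact: measurableT_comp mcosphase (mshift xi).
- by move=> z; exact: norm_cos_le1.
by apply: eq_Rintegral => w _; have [-> _] := FL (w - xi).
Qed.

Let smooth_sin e xi : 0 < e ->
  \int[mu]_x (laplace_cV e x *
    (sinT x * cos (phase (x, xi)) - cosT x * sin (phase (x, xi)))) = 0.
Proof.
move=> e0; have [iL FL] := @laplace_cV_fourier R n e e0.
transitivity (\int[mu]_x (laplace_cV e x *
    \int[mu]_w (g w * sin (phase (x, w - xi))))).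
  apply: eq_Rintegral => x _; congr (_ * _).
  rewrite -!RintegralZr// -RintegralB//; last 2 first.
  - exact: integrableZr (isin x).
  - exact: integrableZr (icos x).
  by apply: eq_Rintegral => w _; rewrite phaseB sinB; ring.
rewrite (@RFubini_bounded_kernel _ _ _ _ _ mu mu _ _
  (fun p => sin (phase (p.1, p.2 - xi))) 1)//; last 2 first.
- exact: measurableT_comp msinphase (mshift xi).
- by move=> z; exact: norm_sin_le1.
under eq_Rintegral => w _ do have [_ ->] := FL (w - xi).
by under eq_Rintegral do rewrite mulr0; rewrite Rintegral_cst// mul0r.
Qed.

(* [psi] is the inverse Fourier transform of g. Damping it by [laplace_cV e]
   makes it integrable, and smooths its Fourier transform g with the Poisson
   kernel. *)
Let psi x := Complex (cosT x) (sinT x).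
Let psi_ e x := Complex (laplace_cV e x * cosT x) (laplace_cV e x * sinT x).

Let fourier_psi_ e : 0 < e ->
  fourierL1 (psi_ e) = (fun xi => Complex (smooth e xi) 0).
Proof.
move=> e0; apply/funext => xi; rewrite /fourierL1 /integralC; congr Complex.
  rewrite -smooth_cos//; apply: eq_Rintegral => x _.
  by rewrite /= cosN sinN /phase/=; ring.
rewrite -(smooth_sin xi e0); apply: eq_Rintegral => x _.
by rewrite /= cosN sinN /phase/=; ring.
Qed.

Let shift_poisson e xi : 0 < e ->
  (\int[mu]_w (poisson_cV e (w - xi))%:E = 1)%E.
Proof.
move=> e0; rewrite (ge0_integral_lebesgue_cV_affine xi ltr01); last 2 first.
- apply/measurable_EFinP; apply: measurableT_comp (measurable_poisson_cV e0) _.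
  exact: msub.
- by move=> w; rewrite lee_fin poisson_cV_ge0// ltW.
rewrite expr1n mul1e -(integral_poisson_cV n e0); apply: eq_integral => w _.
by rewrite scale1r addrC addKr.
Qed.

Let mpoisson_shift e xi : 0 < e -> measurable_fun setT (fun w => poisson_cV e (w - xi)).
Proof.
move=> e0; apply: measurableT_comp (measurable_poisson_cV e0) _.
exact: msub.
Qed.

Let ipoisson_shift e xi : 0 < e ->
  mu.-integrable setT (EFin \o (fun w => poisson_cV e (w - xi))).
Proof.
move=> e0; apply/integrableP; split; first by apply/measurable_EFinP; exact: mpoisson_shift.
under eq_integral do rewrite /= ger0_norm ?poisson_cV_ge0 ?(ltW e0)//.
by rewrite shift_poisson// ltry.
Qed.

Let normg w : `|g w| <= M.
Proof. by rewrite ger0_norm. Qed.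

Let ismooth e xi : 0 < e ->
  mu.-integrable setT (EFin \o (fun w => g w * poisson_cV e (w - xi))).
Proof.
move=> e0; apply: eq_integrable (integrableMbounded (ipoisson_shift xi e0) mg normg) => //.
by move=> w _; rewrite /= mulrC.
Qed.

Let smoothE e xi : 0 < e ->
  (smooth e xi)%:E = (\int[mu]_w (g w * poisson_cV e (w - xi))%:E)%E.
Proof.
by move=> e0; rewrite /smooth /Rintegral fineK//; exact: integrable_fin_num (ismooth xi e0).
Qed.

Let smooth_ge0 e xi : 0 < e -> 0 <= smooth e xi.
Proof.
by move=> e0; apply: Rintegral_ge0 => w _; rewrite mulr_ge0// poisson_cV_ge0// ltW.
Qed.

Let smooth_le e xi : 0 < e -> smooth e xi <= M.
Proof.
move=> e0; apply: (@le_trans _ _ (\int[mu]_w (M * poisson_cV e (w - xi)))).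
  apply: le_Rintegral => //; first exact: ismooth.
    exact: integrableZl (ipoisson_shift xi e0).
  by move=> w _; rewrite ler_wpM2r// poisson_cV_ge0// ltW.
rewrite RintegralZl//; last exact: ipoisson_shift.
by rewrite /Rintegral shift_poisson//= mulr1.
Qed.

Let mkernel e : 0 < e ->
  measurable_fun setT (fun p : 'cV[R]_n * 'cV[R]_n => g p.2 * poisson_cV e (p.2 - p.1)).
Proof.
move=> e0; apply: measurable_funM.
  exact: measurableT_comp mg measurable_snd.
apply: measurable_prod => i _; apply: measurableT_comp (measurable_poisson e0) _.
rewrite [X in measurable_fun _ X](_ : _ =
    (fun p : 'cV[R]_n * 'cV[R]_n => p.2 i 0 - p.1 i 0)); last first.
  by apply/funext => p; rewrite !mxE.
apply: measurable_funB.
  exact: measurableT_comp (@measurable_coord_mx R n 1 i 0) measurable_snd.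
exact: measurableT_comp (@measurable_coord_mx R n 1 i 0) measurable_fst.
Qed.

Let msmooth e : 0 < e -> measurable_fun setT (smooth e).
Proof.
by move=> e0; exact: (@measurable_fun_Rintegral _ _ _ _ _ mu _ (mkernel e0)).
Qed.

(** Tonelli, the Poisson kernel being even and of mass 1. Equality of the masses of [smooth e] and g
    is what makes Scheffe's argument applicable. *)
Let integral_smooth e : 0 < e ->
  (\int[mu]_xi (smooth e xi)%:E = \int[mu]_w (g w)%:E)%E.
Proof.
move=> e0; under eq_integral do rewrite smoothE//.
rewrite (@fubini_tonelli _ _ _ _ _ mu mu
    (fun p => (g p.2 * poisson_cV e (p.2 - p.1))%:E)); last 2 first.
- by apply/measurable_EFinP; exact: mkernel.
- by move=> p; rewrite lee_fin mulr_ge0// poisson_cV_ge0// ltW.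
apply: eq_integral => w _ /=; under eq_integral do rewrite EFinM.
rewrite ge0_integralZl//; last 3 first.
- apply/measurable_EFinP; rewrite [X in measurable_fun _ X](_ : _ =
    (fun x => poisson_cV e (x - w))); first exact: mpoisson_shift.
  by apply/funext => x; rewrite -poisson_cVN opprB.
- by move=> x _; rewrite lee_fin poisson_cV_ge0// ltW.
- by rewrite lee_fin.
under eq_integral do rewrite -poisson_cVN opprB.
by rewrite shift_poisson// mule1.
Qed.

Let isg e : 0 < e -> mu.-integrable setT (EFin \o smooth e).
Proof.
move=> e0; apply/integrableP; split; first by apply/measurable_EFinP; exact: msmooth.
under eq_integral do rewrite /= ger0_norm ?smooth_ge0//.
by rewrite integral_smooth//; exact: integrable_lty ig.
Qed.

Let e_ (k : nat) : R := k.+1%:R^-1.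

Let e_gt0 k : 0 < e_ k. Proof. by rewrite invr_gt0. Qed.

Let e_cvg : e_ @ \oo --> 0.
Proof. exact: cvg_harmonic. Qed.

(** The substitution w = xi + e y exhibits the left-hand side as the mean of g (xi + e y) under the
    fixed density [poisson_cV 1]; continuity of g and its bound M allow dominated convergence. *)
Let smooth_cvg xi : smooth (e_ k) xi @[k --> \oo] --> g xi.
Proof.
have smoothE' k : (smooth (e_ k) xi)%:E =
    (\int[mu]_y (g (xi + e_ k *: y) * poisson_cV 1 y)%:E)%E.
  have ek0 := e_gt0 k.
  rewrite smoothE// (ge0_integral_lebesgue_cV_affine xi ek0); last 2 first.
  - by apply/measurable_EFinP; apply: measurable_funM => //; exact: mpoisson_shift.
  - by move=> w; rewrite lee_fin mulr_ge0// poisson_cV_ge0// ltW.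
  have maff := continuous_measurable_mx (@continuous_affine_mx R n 1 xi (e_ k)).
  rewrite -ge0_integralZl//; last 3 first.
  - apply/measurable_EFinP; apply: measurable_funM.
      exact: measurableT_comp mg maff.
    exact: measurableT_comp (mpoisson_shift xi ek0) maff.
  - by move=> w _; rewrite lee_fin mulr_ge0// poisson_cV_ge0// ltW.
  - by rewrite lee_fin exprn_ge0// ltW.
  apply: eq_integral => y _; rewrite -EFinM (addrC xi) addrK mulrCA poisson_cVZ//.
have mp1 := @measurable_poisson_cV R n 1 ltr01.
have ip1 : mu.-integrable setT (EFin \o (poisson_cV 1 : 'cV[R]_n -> R)).
  have := ipoisson_shift 0 ltr01; apply: eq_integrable => // w _.
  by rewrite /= subr0.
have H : (\int[mu]_y (g (xi + e_ k *: y) * poisson_cV 1 y)%:E)%E @[k --> \oo] -->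
    (\int[mu]_y (g xi * poisson_cV 1 y)%:E)%E.
  have [|||||//] := @dominated_convergence _ _ _ mu setT measurableT
    (fun k y => (g (xi + e_ k *: y) * poisson_cV 1 y)%:E)
    (fun y => (g xi * poisson_cV 1 y)%:E)
    (fun y => (M * poisson_cV 1 y)%:E).
  - move=> k; apply/measurable_EFinP; apply: measurable_funM => //.
    have maff := continuous_measurable_mx (@continuous_affine_mx R n 1 xi (e_ k)).
    exact: measurableT_comp mg maff.
  - by apply/measurable_EFinP; apply: measurable_funM.
  - apply: nearW => y _; apply: cvg_EFin; first exact: nearW.
    rewrite /comp/=; apply: cvgMr_tmp; apply: continuous_cvg; first exact: cg.
    apply: cvg_mx => i j.
    have -> : (fun k => (xi + e_ k *: y) i j) = (fun k => xi i j + e_ k * y i j).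
      by apply/funext => k; rewrite !mxE.
    rewrite -[X in _ --> X]addr0; apply: cvgD; first exact: cvg_cst.
    by rewrite -[X in _ --> X](mul0r (y i j)); apply: cvgMr_tmp.
  - exact: (integrableZl measurableT M ip1).
  - apply: nearW => y k _; rewrite /= lee_fin normrM (ger0_norm (g0 _)).
    by rewrite ger0_norm ?poisson_cV_ge0// ler_wpM2r// poisson_cV_ge0.
have limE : (\int[mu]_y (g xi * poisson_cV 1 y)%:E = (g xi)%:E)%E.
  by under eq_integral do rewrite EFinM; rewrite integralZl// integral_poisson_cV// mule1.
move: H; rewrite limE; under eq_cvg do rewrite -smoothE'.
by move=> /fine_cvgP[_]; exact.
Qed.

Let power x := cosT x ^+ 2 + sinT x ^+ 2.

Let power_ge0 x : 0 <= power x.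
Proof. by rewrite addr_ge0 ?sqr_ge0. Qed.

Let mpower : measurable_fun setT power.
Proof. by apply: measurable_funD; exact: measurable_funX. Qed.

Let I_ge0 : 0 <= I.
Proof. exact: Rintegral_ge0. Qed.

Let power_le x : `|power x| <= I ^+ 2 + I ^+ 2.
Proof.
by rewrite ger0_norm// lerD// -real_normK ?num_real// lerXn2r ?nnegrE.
Qed.

(* By Fubini, the left-hand side is the integral of g * smooth e. *)
Let integral_laplace_power e : 0 < e ->
  (\int[mu]_x (laplace_cV e x * power x)%:E <= (M * I)%:E)%E.
Proof.
move=> e0; have [iL _] := @laplace_cV_fourier R n e e0.
have /integrable_fin_num/fineK <- // := integrableMbounded iL mpower power_le.
rewrite lee_fin.
(* Integrating g w * u (x, w) over w gives [power x], that is |psi x|^2; integrating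
   [laplace_cV e x * u (x, w)] over x gives [smooth e w]. *)
pose u (p : 'cV[R]_n * 'cV[R]_n) :=
  cosT p.1 * cos (phase p) + sinT p.1 * sin (phase p).
have mu_ : measurable_fun setT u.
  apply: measurable_funD; apply: measurable_funM => //.
    exact: measurableT_comp mcosT measurable_fst.
  exact: measurableT_comp msinT measurable_fst.
have u_le p : `|u p| <= I + I.
  rewrite (le_trans (ler_normD _ _))// lerD// normrM.
    by rewrite -[leRHS]mulr1 ler_pM// norm_cos_le1.
  by rewrite -[leRHS]mulr1 ler_pM// norm_sin_le1.
rewrite (_ : fine _ = \int[mu]_x (laplace_cV e x * \int[mu]_w (g w * u (x, w)))).
  rewrite (RFubini_bounded_kernel iL ig mu_ u_le).
  rewrite /u; under eq_Rintegral do rewrite smooth_cos//.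
  rewrite mulrC -RintegralZr//; apply: le_Rintegral => //.
  - apply: (integrableMbounded ig (msmooth e0) (B := M)) => w.
    by rewrite ger0_norm ?smooth_ge0 ?smooth_le.
  - exact: integrableZr ig.
  - by move=> w _; rewrite ler_wpM2l// smooth_le.
apply: eq_Rintegral => x _; congr (_ * _).
rewrite /power !expr2 {1}/cosT {1}/sinT -!RintegralZr// -RintegralD//; last 2 first.
- exact: integrableZr (icos x).
- exact: integrableZr (isin x).
by apply: eq_Rintegral => w _; rewrite /u/=; ring.
Qed.

(** This puts [psi] in L^2 in place of Plancherel: as e decreases to 0 the damping factor increases
    to 1, and monotone convergence carries over the bound M I, which does not depend on e. *)
Let ipower : mu.-integrable setT (EFin \o power).
Proof.
apply/integrableP; split; first by apply/measurable_EFinP.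
under eq_integral do rewrite /= ger0_norm//.
apply: (@le_lt_trans _ _ (M * I)%:E); last exact: ltry.
have mlp k : measurable_fun setT (fun x => (laplace_cV (e_ k) x * power x)%:E).
  by apply/measurable_EFinP; apply: measurable_funM => //; exact: measurable_laplace_cV.
have lp0 k x : setT x -> (0 <= (laplace_cV (e_ k) x * power x)%:E)%E.
  by move=> _; rewrite lee_fin mulr_ge0// ltW// laplace_cV_gt0.
have lp_nd x : setT x ->
    nondecreasing_seq (fun k => (laplace_cV (e_ k) x * power x)%:E).
  move=> _ j k jk; rewrite lee_fin ler_wpM2r// le_laplace_cV//.
  by rewrite lef_pV2 ?posrE// ler_nat.
have := @cvg_monotone_convergence _ _ _ mu setT measurableT _ mlp lp0 lp_nd.
rewrite (eq_integral (EFin \o power)); last first.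
  move=> x _; apply/cvg_lim => //; apply: cvg_EFin; first exact: nearW.
  rewrite /comp/= -[X in _ --> X]mul1r; apply: cvgMr_tmp.
  exact: cvg_laplace_cV.
move=> /cvg_lim <- //; apply: lime_le.
  apply: ereal_nondecreasing_is_cvgn => j k jk; apply: ge0_le_integral => //.
  - by move=> x Tx; exact: lp0.
  - by move=> x Tx; exact: lp_nd.
by apply: nearW => k; exact: integral_laplace_power.
Qed.

Let sum_sqr_le (z t : R) : `|t| <= 1 -> 0 <= z -> `|t ^+ 2 * z| <= z.
Proof.
move=> t1 z0; rewrite normrM (ger0_norm z0) ler_piMl// normrX.
by rewrite exprn_ile1.
Qed.

(** The damped functions [psi_ (e_ k)] are the approximating sequence. They are in L^1 because the
    two components of [psi] are bounded by I, in L^2 because [power] is integrable, and they tend to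
    [psi] by domination by [power]. Their transforms [smooth (e_ k)] tend to g in L^1 by Scheffe,
    hence in L^2 since the differences are bounded by M. *)
Lemma exists_inverse_fourier :
  exists psi : 'cV[R]_n -> R[i], is_fourierL2 psi (fun x => (g x)%:C%C).
Proof.
have mpsi : measurable_funC psi by split.
have mlap e := @measurable_laplace_cV R n e.
have mpsi_ e : measurable_funC (psi_ e).
  by split=> /=; exact: measurable_funM.
have M0 : 0 <= M := le_trans (g0 0) (gM 0).
exists psi; split.
- exact: LfunC2_integrable mpsi ipower.
- apply: LfunC2_integrable; first by split=> //=; exact: measurable_cst.
  apply: eq_integrable (integrableMbounded ig mg normg) => // x _.
  by rewrite /= expr0n addr0 expr2.
exists (fun k => psi_ (e_ k)); split.
- move=> k; have [iL _] := @laplace_cV_fourier R n (e_ k) (e_gt0 k).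
  have L1 x : `|laplace_cV (e_ k) x| <= 1.
    by rewrite ger0_norm ?laplace_cV_le1// ltW// laplace_cV_gt0.
  split; last first.
    apply: LfunC2_integrable => //=.
    apply: eq_integrable (integrableMbounded ipower _
      (fun x => _ : `|laplace_cV (e_ k) x ^+ 2| <= 1)) => //.
    + by move=> x _; rewrite /= !exprMn -mulrDr mulrC.
    + exact: measurable_funX.
    + by move=> x; rewrite normrX exprn_ile1.
  apply: LfunC1_integrable => //.
  + exact: (integrableMbounded iL mcosT cosT_le).
  + exact: (integrableMbounded iL msinT sinT_le).
- have diffE k x : complex.Re (psi_ (e_ k) x - psi x) ^+ 2 +
      complex.Im (psi_ (e_ k) x - psi x) ^+ 2 =
      (laplace_cV (e_ k) x - 1) ^+ 2 * power x.
    by rewrite /= /power; ring.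
  have L1 k x : `|laplace_cV (e_ k) x - 1| <= 1.
    rewrite distrC ger0_norm ?subr_ge0 ?laplace_cV_le1 ?(ltW (e_gt0 _))//.
    by rewrite gerBl ltW// laplace_cV_gt0.
  have mdiff k : measurable_fun setT (fun x => (laplace_cV (e_ k) x - 1) ^+ 2 * power x).
    apply: measurable_funM => //; apply: measurable_funX.
    by apply: measurable_funB => //.
  apply: cvgL2_integral.
    move=> k; apply: (le_integrable measurableT _ _ ipower).
      apply/measurable_EFinP.
      by rewrite [X in measurable_fun _ X](funext (diffE k)).
    by move=> x _; rewrite /= lee_fin diffE (ger0_norm (power_ge0 x)) sum_sqr_le.
  under eq_cvg do under eq_integral do rewrite diffE.
  have [|||||_ _] := @dominated_convergence _ _ _ mu setT measurableT
    (fun k x => ((laplace_cV (e_ k) x - 1) ^+ 2 * power x)%:E) (cst 0%E)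
    (EFin \o power) => //.
  + by move=> k; apply/measurable_EFinP.
  + apply: nearW => x _; apply: cvg_EFin; first exact: nearW.
    rewrite /comp/= -[X in _ --> X](mul0r (power x)); apply: cvgMr_tmp.
    have h : laplace_cV (e_ k) x - 1 @[k --> \oo] --> (0 : R).
      rewrite -[X in _ --> X](subrr 1); apply: cvgB; last exact: cvg_cst.
      exact: cvg_laplace_cV.
    by rewrite -[X in _ --> X](mulr0 0); under eq_cvg do rewrite expr2; exact: cvgM.
  + by apply: nearW => x k _; rewrite /= lee_fin sum_sqr_le.
  by rewrite integral0.
- pose d k x := smooth (e_ k) x - g x.
  have md k : measurable_fun setT (d k).
    by apply: measurable_funB => //; exact: msmooth.
  have d_le k x : `|d k x| <= M.
    have := smooth_ge0 x (e_gt0 k); have := smooth_le x (e_gt0 k).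
    have := g0 x; have := gM x; rewrite /d.
    by move: (smooth _ _) (g x) => s t; rewrite ler_norml => *; apply/andP; split; lra.
  have id k : mu.-integrable setT (EFin \o d k).
    apply: eq_integrable (integrableB measurableT (isg (e_gt0 k)) ig) => //.
  have diffE k x : complex.Re (fourierL1 (psi_ (e_ k)) x - (g x)%:C%C) ^+ 2 +
      complex.Im (fourierL1 (psi_ (e_ k)) x - (g x)%:C%C) ^+ 2 = d k x * d k x.
    by rewrite fourier_psi_// /= subrr expr0n addr0 expr2.
  have idd k : mu.-integrable setT (EFin \o (fun x => d k x * d k x)).
    exact: integrableMbounded (id k) (md k) (d_le k).
  apply: cvgL2_integral.
    by move=> k; apply: eq_integrable (idd k) => // x _; rewrite /= diffE.
  rewrite [X in X @ _ --> _](_ : _ =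
    (fun k => \int[mu]_x (d k x * d k x)%:E)%E); last first.
    by apply/funext => k; apply: eq_integral => x _; rewrite diffE.
  (* Scheffe's argument: d k has integral 0, and its negative part is dominated
     by g. *)
  pose h k x := maxr (- d k x) 0.
  have mh k : measurable_fun setT (h k).
    by apply: measurable_maxr => //; exact: measurableT_comp.
  have h0 k x : 0 <= h k x by rewrite le_max lexx orbT.
  have hg k x : h k x <= g x.
    by rewrite ge_max g0 andbT opprB gerBl smooth_ge0.
  have ih k : mu.-integrable setT (EFin \o h k).
    apply: le_integrable ig => //; first by apply/measurable_EFinP.
    by move=> x _; rewrite /= lee_fin !ger0_norm.
  have h_cvg : (\int[mu]_x (h k x)%:E)%E @[k --> \oo] --> 0%E.
    have [|||||_ _] := @dominated_convergence _ _ _ mu setT measurableT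
      (fun k x => (h k x)%:E) (cst 0%E) (EFin \o g) => //.
    + by move=> k; apply/measurable_EFinP.
    + apply: nearW => x _; apply: cvg_EFin; first exact: nearW.
      have d_cvg : `|d k x| @[k --> \oo] --> (0 : R).
        rewrite -[X in _ --> X](normr0 R) -(subrr (g x)); apply: cvg_norm.
        by apply: cvgB; [exact: smooth_cvg|exact: cvg_cst].
      apply: squeeze_cvgr d_cvg; last exact: cvg_cst.
      apply: nearW => k /=; rewrite h0/= ge_max normr_ge0 andbT.
      by rewrite -normrN ler_norm.
    + by apply: nearW => x k _; rewrite /= lee_fin ger0_norm.
    by rewrite integral0.
  (* Pointwise |d| = 2 h + d, where d has integral 0. *)
  have dE k : (\int[mu]_x (`|d k x|)%:E = 2%:E * \int[mu]_x (h k x)%:E)%E.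
    rewrite -integralZl//; last exact: ih.
    transitivity (\int[mu]_x ((2 * h k x)%:E + (d k x)%:E))%E.
      apply: eq_integral => x _; rewrite -EFinD; congr EFin; rewrite /h.
      move: (d k x) => z.
      by case: (ger0P z) => dk; case: (lerP (- z) 0) => dk'; lra.
    rewrite (integralD measurableT (integrableZl measurableT 2 (ih k)) (id k)) /=.
    rewrite [X in (_ + X)%E = _](_ : _ = 0%E) ?adde0//.
    rewrite (integralB_EFin measurableT (isg (e_gt0 k)) ig) integral_smooth//.
    by rewrite subee//; exact: integrable_fin_num ig.
  (* From |d| <= M follows d^2 <= M |d|, whose integral is 2 M times that of h. *)
  have bound : ((M * 2)%:E * \int[mu]_x (h k x)%:E)%E @[k --> \oo] --> 0%E.
    by rewrite -[X in _ --> X](mule0 (M * 2)%:E); exact: cvgeZl.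
  apply: squeeze_cvge bound; last exact: cvg_cst.
  + apply: nearW => k /=; rewrite integral_ge0//=; last first.
      by move=> x _; rewrite lee_fin -expr2 sqr_ge0.
    rewrite EFinM -muleA -dE -ge0_integralZl//; last first.
      by apply/measurable_EFinP; apply: measurableT_comp.
    apply: ge0_le_integral => //.
    * by move=> x _; rewrite lee_fin -expr2 sqr_ge0.
    * by apply/measurable_EFinP; exact: measurable_funM.
    * by apply/measurable_EFinP; apply: measurable_funM => //; apply: measurableT_comp.
    * move=> x _; rewrite -EFinM lee_fin -expr2 -real_normK ?num_real// expr2.
      by rewrite ler_wpM2r.
Qed.

End inverse_fourier.

(** * The matrix exponential *)

Section matrix_exponential.
Variables (R : realType) (n : nat) (X : 'M[R]_n).

(** A submultiplicative norm dominating every entry; it compares the entries of e^{tX} with the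
    scalar series of e^{s |t|}. *)
Let s := \sum_i \sum_j `|X i j|.

Let s_ge0 : 0 <= s.
Proof. by apply: sumr_ge0 => i _; exact: sumr_ge0. Qed.

Lemma norm_expmx_coeff_le k i j : `|(X ^+ k) i j| <= s ^+ k.
Proof.
elim: k i j => [|k IH] i j.
  by rewrite !expr0 mxE; case: eqP; rewrite ?normr1 ?normr0.
rewrite exprS mxE (le_trans (ler_norm_sum _ _ _))//.
apply: (@le_trans _ _ (\sum_l `|X i l| * s ^+ k)).
  by apply: ler_sum => l _; rewrite normrM ler_wpM2l.
rewrite -mulr_suml exprS ler_wpM2r ?exprn_ge0//.
by rewrite [leRHS](bigD1 i)//= lerDl sumr_ge0// => l _; exact: sumr_ge0.
Qed.

(** Entry by entry, e^{tX} is a scalar power series in t, to which termwise differentiation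
    applies. *)
Definition expmx_coeff i j k : R := k`!%:R^-1 * (X ^+ k) i j.

Lemma is_cvg_expmx_coeff i j t : cvgn (pseries (expmx_coeff i j) t).
Proof.
apply: normed_cvg.
apply: series_le_cvg (is_cvg_series_exp_coeff (s * `|t|)) => k /=.
- exact: normr_ge0.
- by rewrite divr_ge0// exprn_ge0// mulr_ge0.
- rewrite /exp_coeff /= exprMn /expmx_coeff !normrM normrX normfV normr_nat.
  by rewrite -mulrA mulrC ler_wpM2r// ler_wpM2r ?exprn_ge0// norm_expmx_coeff_le.
Qed.

Lemma expr_scalemx t k : (t *: X) ^+ k = t ^+ k *: X ^+ k.
Proof.
elim: k => [|k IH]; first by rewrite !expr0 scale1r.
by rewrite !exprS IH -!mulmxE -scalemxAl -scalemxAr scalerA.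
Qed.

Lemma cvg_expmx t :
  series (fun k => k`!%:R^-1 *: (t *: X) ^+ k) @ \oo -->
  (\matrix_(i, j) limn (pseries (expmx_coeff i j) t) : 'M[R]_n).
Proof.
apply: cvg_mx => i j; rewrite mxE.
rewrite (_ : (fun _ => _) = pseries (expmx_coeff i j) t).
  exact: is_cvg_expmx_coeff.
apply/funext => N; rewrite /pseries /series /= summxE; apply: eq_bigr => k _.
by rewrite expr_scalemx !mxE /expmx_coeff; ring.
Qed.

Lemma expmxE t i j :
  expmx (t *: X) i j = limn (pseries (expmx_coeff i j) t).
Proof.
rewrite /expmx (cvg_lim _ (@cvg_expmx t)) ?mxE//.
Qed.

(** The derived series, with a factor X taken out on the left. The companion takes it out on the
    right, and comparing the two limits proves that X commutes with e^{tX}. *)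
Lemma expmx_coeff_diffsl i j k :
  pseries_diffs (expmx_coeff i j) k = \sum_l X i l * expmx_coeff l j k.
Proof.
rewrite /pseries_diffs /expmx_coeff exprS mxE mulrA factS natrM invfM.
rewrite mulrA mulfV ?pnatr_eq0// mul1r mulr_sumr.
by apply: eq_bigr => l _; rewrite mulrCA.
Qed.

Lemma expmx_coeff_diffsr i j k :
  pseries_diffs (expmx_coeff i j) k = \sum_l expmx_coeff i l k * X l j.
Proof.
rewrite /pseries_diffs /expmx_coeff exprSr mxE mulrA factS natrM invfM.
rewrite mulrA mulfV ?pnatr_eq0// mul1r mulr_sumr.
by apply: eq_bigr => l _; rewrite mulrA.
Qed.

Lemma pseries_sum (a : 'I_n -> R) (c : 'I_n -> R^nat) (L : 'I_n -> R) t :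
  (forall l, pseries (c l) t @ \oo --> L l) ->
  pseries (fun k => \sum_l a l * c l k) t @ \oo --> \sum_l a l * L l.
Proof.
move=> cL; rewrite (_ : pseries _ t =
    (fun N => \sum_l a l * pseries (c l) t N)); last first.
  apply/funext => N; rewrite /pseries /series /=.
  under [RHS]eq_bigr do rewrite mulr_sumr.
  rewrite exchange_big /=; apply: eq_bigr => k _; rewrite mulr_suml.
  by apply: eq_bigr => l _; rewrite mulrA.
elim: (index_enum _) => [|l r IH].
  rewrite big_nil (_ : (fun N => _) = cst 0); first exact: cvg_cst.
  by apply/funext => N; rewrite big_nil.
rewrite big_cons (_ : (fun N => _) = (fun N => a l * pseries (c l) t N +
    \sum_(l <- r) a l * pseries (c l) t N)).
  by apply: cvgD IH; apply: cvgMl_tmp; exact: cL.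
by apply/funext => N; rewrite big_cons.
Qed.

Lemma cvg_expmx_diffs i j t :
  pseries (pseries_diffs (expmx_coeff i j)) t @ \oo --> (X *m expmx (t *: X)) i j.
Proof.
rewrite mxE (funext (expmx_coeff_diffsl i j)).
under eq_bigr do rewrite expmxE.
by apply: pseries_sum => l; exact: is_cvg_expmx_coeff.
Qed.

Lemma is_cvg_expmx_diffs2 i j t :
  cvgn (pseries (pseries_diffs (pseries_diffs (expmx_coeff i j))) t).
Proof.
rewrite (_ : pseries_diffs (pseries_diffs _) =
    (fun k => \sum_l X i l * pseries_diffs (expmx_coeff l j) k)); last first.
  apply/funext => k; rewrite {1}/pseries_diffs expmx_coeff_diffsl mulr_sumr.
  by apply: eq_bigr => l _; rewrite /pseries_diffs mulrCA.
apply/cvg_ex; eexists; apply: pseries_sum => l.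
exact: cvg_expmx_diffs.
Qed.

Lemma is_derive_expmx (t : R) i j :
  is_derive t (1 : R) (fun t => expmx (t *: X) i j) ((X *m expmx (t *: X)) i j).
Proof.
rewrite (_ : (fun t => expmx (t *: X) i j) =
    (fun t => limn (pseries (expmx_coeff i j) t))); last first.
  by apply/funext => r; rewrite expmxE.
rewrite -(cvg_lim _ (@cvg_expmx_diffs i j t))//.
(* The series and its first two derived series must converge at some point of modulus greater than
   |t|; they converge everywhere. *)
apply: (@pseries_snd_diffs _ _ (`|t| + 1)).
- exact: is_cvg_expmx_coeff.
- by apply/cvg_ex; eexists; exact: cvg_expmx_diffs.
- exact: is_cvg_expmx_diffs2.
- by rewrite [ltRHS]ger0_norm// ltrDl.
Qed.

Lemma expmx_comm t : X *m expmx (t *: X) = expmx (t *: X) *m X.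
Proof.
apply/matrixP => i j; rewrite -(cvg_lim _ (@cvg_expmx_diffs i j t))//.
apply: cvg_lim => //; rewrite mxE (funext (expmx_coeff_diffsr i j)).
under eq_bigr do rewrite expmxE mulrC.
rewrite (_ : (fun k => _) = (fun k => \sum_l X l j * expmx_coeff i l k)).
  by apply: pseries_sum => l; exact: is_cvg_expmx_coeff.
by apply/funext => k; apply: eq_bigr => l _; rewrite mulrC.
Qed.

Lemma expmx0 : expmx (0 *: X) = 1%:M.
Proof.
apply/matrixP => i j; rewrite expmxE; apply: cvg_lim => //.
(* The empty partial sum is 0, hence the shift; all later ones equal the term of index 0. *)
rewrite -(cvg_shiftS (pseries _ _)); rewrite (_ : (fun _ => _) = cst (1%:M i j)).
  exact: cvg_cst.
apply/funext => N; rewrite /pseries /series /= big_nat_recl// big1 => [|k _].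
  by rewrite expr0 mulr1 addr0 /expmx_coeff fact0 invr1 mul1r expr0.
by rewrite exprS mul0r mulr0.
Qed.

End matrix_exponential.

Section matrix_derivative.
Variable R : realType.

Lemma is_derive_mulmx m p q (A : R -> 'M[R]_(m, p)) (B : R -> 'M[R]_(p, q))
    (t : R) (A' : 'M[R]_(m, p)) (B' : 'M[R]_(p, q)) i j :
  (forall i j, is_derive t (1 : R) (fun t => A t i j) (A' i j)) ->
  (forall i j, is_derive t (1 : R) (fun t => B t i j) (B' i j)) ->
  is_derive t (1 : R) (fun t => (A t *m B t) i j) ((A' *m B t + A t *m B') i j).
Proof.
move=> dA dB.
rewrite (_ : (fun t => _) = \sum_l ((fun t => A t i l) * (fun t => B t l j))).
  rewrite !mxE -big_split /=; apply: is_derive_sum => l.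
  rewrite addrC -[A' i l * _]mulrC; exact: is_deriveM.
by apply/funext => r; rewrite mxE fct_sumE.
Qed.

Lemma is_derive_cst_mx m p (A : 'M[R]_(m, p)) (t : R) i j :
  is_derive t (1 : R) (fun t => A i j) ((0 : 'M[R]_(m, p)) i j).
Proof. by rewrite mxE; exact: is_derive_cst. Qed.

End matrix_derivative.

(** * The one-parameter group generated by X *)

Section one_parameter_group.
Variables (R : realType) (n : nat) (X : 'M[R]_n).
Local Notation phi t := (expmx (t *: X)).

Lemma is_derive_expmxr (t : R) i j :
  is_derive t (1 : R) (fun t => phi t i j) ((phi t *m X) i j).
Proof. by rewrite -expmx_comm; exact: is_derive_expmx. Qed.

(** The derivative in t vanishes because X commutes with phi, so the value is that at t = 0. The
    group law follows without multiplying series. *)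
Lemma expmxNM s t : phi (- t) *m phi (t + s) = phi s.
Proof.
apply/matrixP => i j.
transitivity ((phi (- 0) *m phi (0 + s)) i j); last by rewrite oppr0 expmx0 mul1mx add0r.
pose f t := (phi (- t) *m phi (t + s)) i j.
apply: (is_derive_0_is_cst (f := f)) => {}t.
have -> : 0 = ((- (phi (- t) *m X)) *m phi (t + s) +
               phi (- t) *m (X *m phi (t + s))) i j.
  by rewrite mulNmx mulmxA addNr mxE.
apply: is_derive_mulmx => i' j'.
  rewrite mxE -mulrN1.
  apply: (@is_derive1_comp R (fun t => phi t i' j') -%R).
  exact: is_derive_expmxr.
rewrite -[X in is_derive _ _ _ X]mulr1.
have : is_derive t 1 (fun t => t + s) 1.
  by rewrite -[X in is_derive _ _ _ X]addr0; exact: is_deriveD.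
move=> ds; apply: (@is_derive1_comp R (fun t => phi t i' j') (fun t => t + s)).
exact: is_derive_expmx.
Qed.

Lemma expmxD s t : phi (s + t) = phi s *m phi t.
Proof. by rewrite -[LHS](expmxNM _ (- s)) addKr opprK. Qed.

Lemma expmxN t : phi t *m phi (- t) = 1%:M.
Proof. by rewrite -expmxD subrr expmx0. Qed.

Lemma expmxNl t : phi (- t) *m phi t = 1%:M.
Proof. by rewrite -expmxD addNr expmx0. Qed.

Lemma expmx_unit t : phi t \in unitmx.
Proof. by have /mulmx1_unit[] := expmxN t. Qed.

Lemma invmx_expmx t : invmx (phi t) = phi (- t).
Proof.
by rewrite -[LHS]mulmx1 -(expmxN t) mulmxA mulVmx ?mul1mx// expmx_unit.
Qed.

Lemma continuous_expmx : continuous (fun t : R => phi t).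
Proof.
move=> t; apply: (@cvg_mx _ _ (nbhs t)) => i j.
have : {for t, continuous (fun t : R => phi t i j)}.
  apply/differentiable_continuous/derivable1_diffP.
  by have [] := is_derive_expmx X t i j.
exact.
Qed.

End one_parameter_group.

(** * Quadratic forms *)

Lemma eq_indic (R : realType) (T U : Type) (A : set T) (B : set U) x y :
  (A x <-> B y) -> \1_A x = \1_B y :> R.
Proof.
move=> AB; rewrite !indicE; have [Ax|nAx] := pselect (A x).
  by rewrite (mem_set Ax) (mem_set (AB.1 Ax)).
by rewrite (memNset nAx) memNset// => /AB.2.
Qed.

Section quadratic_form.
Variable R : realType.

Lemma continuous_sum (T : topologicalType) (I : Type) (r : seq I)
    (f : I -> T -> R) :
  (forall i, continuous (f i)) -> continuous (fun x => \sum_(i <- r) f i x).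
Proof.
move=> cf; elim: r => [|i r IH] x.
  have -> : (fun y => \sum_(i <- [::]) f i y) = cst 0.
    by apply/funext => y; rewrite big_nil.
  exact: cvg_cst.
have -> : (fun y => \sum_(j <- i :: r) f j y) =
    (fun y => f i y + \sum_(j <- r) f j y).
  by apply/funext => y; rewrite big_cons.
by apply: cvgD; [exact: cf|exact: IH].
Qed.

Lemma continuous_mul (T : topologicalType) (f g : T -> R) :
  continuous f -> continuous g -> continuous (fun x => f x * g x).
Proof. by move=> cf cg x; apply: cvgM; [exact: cf|exact: cg]. Qed.

Variable n : nat.
Variable S : 'M[R]_n.+1.
Hypothesis S_sym : S^T = S.
Implicit Types u v w : 'rV[R]_n.+1.

Let N v : R := (v *m v^T) 0 0.
Let B u v : R := (u *m S *m v^T) 0 0.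

Let NE v : N v = \sum_i v 0 i ^+ 2.
Proof. by rewrite /N mxE; apply: eq_bigr => i _; rewrite mxE expr2. Qed.

Let N_ge0 v : 0 <= N v.
Proof. by rewrite NE sumr_ge0// => i _; exact: sqr_ge0. Qed.

Let N_eq0 v : N v = 0 -> v = 0.
Proof.
rewrite NE => /eqP; rewrite psumr_eq0; last by move=> i _; exact: sqr_ge0.
move=> /allP v0; apply/rowP => i; rewrite mxE; apply/eqP.
by rewrite -sqrf_eq0; apply: v0; rewrite mem_index_enum.
Qed.

Let continuous_N : continuous N.
Proof.
rewrite (_ : N = (fun v => \sum_i v 0 i * v 0 i)).
  by apply: continuous_sum => i; apply: continuous_mul; exact: coord_continuous.
by apply/funext => v; rewrite NE; under eq_bigr do rewrite expr2.
Qed.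

Let continuous_B : continuous (fun v => B v v).
Proof.
rewrite (_ : (fun v => _) = (fun v : 'rV[R]_n.+1 =>
    \sum_j (\sum_i v 0 i * S i j) * v 0 j)).
  apply: continuous_sum => j; apply: continuous_mul; last exact: coord_continuous.
  apply: continuous_sum => i; apply: continuous_mul; first exact: coord_continuous.
  exact: cst_continuous.
apply/funext => v; rewrite /B mxE; apply: eq_bigr => j _.
by rewrite !mxE.
Qed.

Let compact_sphere : compact [set v | N v = 1].
Proof.
apply: bounded_closed_compact.
  exists 1; split => // x x1 v /= Nv.
  rewrite [leLHS]/normr /= mx_normrE; apply/bigmax_leP; split.
    by rewrite (le_trans _ (ltW x1)).
  move=> [i j] _ /=; rewrite (le_trans _ (ltW x1))// ord1.
  rewrite -(@ler_pXn2r _ 2)// ?nnegrE// expr1n real_normK ?num_real// -Nv NE.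
  by rewrite (bigD1 j)//= lerDl sumr_ge0// => k _; exact: sqr_ge0.
have -> : [set v | N v = 1] = N @^-1` [set 1] by [].
by apply: preimage_closed; [move=> v _; exact: continuous_N|exact: closed_eq].
Qed.

Let NZ t v : N (t *: v) = t ^+ 2 * N v.
Proof. by rewrite /N linearZ/= -scalemxAr -scalemxAl !mxE mulrA expr2. Qed.

Let BZ t v : B (t *: v) (t *: v) = t ^+ 2 * B v v.
Proof.
by rewrite /B linearZ/= -scalemxAr -!scalemxAl [LHS]mxE [X in _ * X]mxE mulrA expr2.
Qed.

(** The only piece of the spectral theorem that is used: the minimum c of the Rayleigh quotient is
    attained on the compact unit sphere, and a minimizer v0 is an eigenvector. Row vectors follow
    the convention of [eigenvalue]. *)
Lemma min_eigenvalue : exists2 c, eigenvalue S c &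
  forall v, c * (v *m v^T) 0 0 <= (v *m S *m v^T) 0 0.
Proof.
have S0 : [set v | N v = 1] !=set0.
  exists (delta_mx 0 0); rewrite /= NE (bigD1 0)//= big1 ?addr0.
    by rewrite mxE !eqxx expr1n.
  by move=> i i0; rewrite mxE (negPf i0) andbF expr0n.
have [v0 /set_mem /= Nv0 minv0] := EVT_min_rV S0 compact_sphere
  (continuous_subspaceT continuous_B).
pose c : R := B v0 v0.
have cB v : c * N v <= B v v.
  have [->|v_neq0] := eqVneq v 0.
    by rewrite /N /B !mul0mx mxE mulr0.
  have Nv : 0 < N v.
    rewrite lt_neqAle N_ge0 andbT eq_sym; apply/eqP => /N_eq0 /eqP.
    exact/negP.
  have := minv0 ((Num.sqrt (N v))^-1 *: v).
  rewrite mem_set => [/(_ isT)|].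
    by rewrite BZ exprVn sqr_sqrtr// mulrC ler_pdivlMr.
  by rewrite /= NZ exprVn sqr_sqrtr// mulVf// gt_eqF.
exists c; last exact: cB.
apply/eigenvalueP; exists v0; last first.
  apply/eqP => v00; move: Nv0; rewrite v00 /N mul0mx mxE => /esym/eqP.
  by rewrite oner_eq0.
(* Otherwise v0 - t r would have a smaller Rayleigh quotient for small t > 0. *)
pose r := v0 *m S - c *: v0; apply/eqP; rewrite -subr_eq0 -/r.
apply/eqP/N_eq0; set a := N r.
(* Twice the right-hand side is the first-order coefficient in t of the nonnegative quantity B - c N
   at v0 + t r. *)
have aE : a = B v0 r - c * (v0 *m r^T) 0 0.
  by rewrite /a /N {1}/r mulmxBl -scalemxAl [LHS]mxE [X in _ + X]mxE [in X in _ - X]mxE.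
have Bsym u v : B u v = B v u.
  by rewrite /B -[in LHS](trmxK (u *m S *m v^T)) [LHS]mxE !trmx_mul trmxK S_sym mulmxA.
have Dsym u v : (u *m v^T) 0 0 = (v *m u^T) 0 0.
  by rewrite -[in LHS](trmxK (u *m v^T)) [LHS]mxE trmx_mul trmxK.
have addE (A C : 'M[R]_1) : (A + C) 0 0 = A 0 0 + C 0 0 by rewrite mxE.
have scaleE t (A : 'M[R]_1) : (t *: A) 0 0 = t * A 0 0 by rewrite mxE.
have trE t : (v0 + t *: r)^T = v0^T + t *: r^T by rewrite linearD linearZ.
have BD t : B (v0 + t *: r) (v0 + t *: r) = c + 2 * t * B v0 r + t ^+ 2 * B r r.
  rewrite {1}/B trE !mulmxDl !mulmxDr -!scalemxAl -!scalemxAr !addE !scaleE.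
  have := Bsym r v0; rewrite /B => ->; rewrite -/(B v0 v0) -/c.
  by ring.
have ND t : N (v0 + t *: r) = 1 + 2 * t * (v0 *m r^T) 0 0 + t ^+ 2 * N r.
  rewrite {1}/N trE !mulmxDl !mulmxDr -!scalemxAl -!scalemxAr !addE !scaleE.
  by rewrite (Dsym r v0) -/(N v0) Nv0 -/(N r); ring.
pose q := B r r - c * N r.
have q0 : 0 <= q by rewrite subr_ge0.
have H t : 0 <= 2 * t * a + t ^+ 2 * q.
  have := cB (v0 + t *: r); rewrite BD ND aE /q.
  by move: (B v0 r) (B r r) (N r) ((v0 *m r^T) 0 0) => ? ? ? ?; lra.
(* The quadratic in t is smallest at - a / q; the denominator q + 1 allows q = 0 and still gives a
   negative value unless a = 0. *)
have := H (- a / (q + 1)); have q1 : 0 < q + 1 by lra.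
have -> : 2 * (- a / (q + 1)) * a + (- a / (q + 1)) ^+ 2 * q =
    - (a ^+ 2 * (q + 2)) / (q + 1) ^+ 2.
  by field; rewrite gt_eqF.
rewrite mulNr oppr_ge0 => a_le0; apply/eqP; rewrite -sqrf_eq0 eq_le sqr_ge0 andbT.
move: a_le0; rewrite pmulr_lle0 ?invr_gt0 ?exprn_gt0// pmulr_lle0//; lra.
Qed.

End quadratic_form.

Section dot_product.
Variables (R : realType) (n : nat).
Implicit Types x y : 'cV[R]_n.

Lemma dot_cV_ge0 x : 0 <= dot_cV x x.
Proof. by rewrite dot_cVE sumr_ge0// => i _; rewrite -expr2 sqr_ge0. Qed.

Lemma dot_cV_gt0 x : x != 0 -> 0 < dot_cV x x.
Proof.
move=> x0; rewrite lt_neqAle dot_cV_ge0 andbT eq_sym; apply: contra x0.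
rewrite dot_cVE psumr_eq0; last by move=> i _; rewrite -expr2 sqr_ge0.
move=> /allP h; apply/eqP/colP => i; rewrite mxE; apply/eqP.
by rewrite -sqrf_eq0 expr2; apply: h; rewrite mem_index_enum.
Qed.

Lemma form_trmx (X : 'M[R]_n) (u : 'rV[R]_n) :
  (u *m X *m u^T) 0 0 = (u *m (X^T *m u^T)) 0 0.
Proof. by rewrite -[in LHS](trmxK (u *m X *m _)) [LHS]mxE !trmx_mul trmxK. Qed.

Lemma dot_cV_symm (X : 'M[R]_n) x :
  dot_cV x (2^-1 *: (X + X^T) *m x) = dot_cV x (X^T *m x).
Proof.
have tr : (x^T *m (X *m x)) 0 0 = (x^T *m (X^T *m x)) 0 0.
  by rewrite -[in LHS](trmxK (x^T *m (X *m x))) [LHS]mxE !trmx_mul trmxK mulmxA.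
rewrite /dot_cV -scalemxAl -scalemxAr mulmxDl mulmxDr [LHS]mxE [X in _ * X]mxE tr.
by field.
Qed.

End dot_product.

Lemma definite_quadratic_form (R : realType) n (X : 'M[R]_n.+1) :
  (forall r, eigenvalue (2^-1 *: (X + X^T)) r -> 0 < r) ->
  exists2 c, 0 < c & forall x : 'cV[R]_n.+1, c * dot_cV x x <= dot_cV x (X^T *m x).
Proof.
set S := 2^-1 *: (X + X^T) => eigS.
have S_sym : S^T = S by rewrite /S linearZ/= linearD/= trmxK addrC.
have [c Sc cmin] := min_eigenvalue S_sym.
exists c; first exact: eigS.
move=> x; rewrite -dot_cV_symm -/S; have := cmin x^T.
by rewrite trmxK -mulmxA.
Qed.

(** * The integral of a nonnegative derivative over the whole line *)

Section line_integral.
Variable R : realType.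
Local Notation leb := (@lebesgue_measure R).

Lemma ge0_integralZl_lebesgue (f : R -> \bar R) (k : R) :
  measurable_fun setT f -> (forall x, 0 <= f x)%E -> 0 <= k ->
  (\int[leb]_x (k%:E * f x) = k%:E * \int[leb]_x f x)%E.
Proof. by move=> mf f0 k0; rewrite ge0_integralZl. Qed.

(** The half-line version is applied to F and, after reflection, to - F (- x); hence the limit at
    -oo is phrased with F (- x). *)
Lemma ge0_continuous_FTC_line (h F : R -> R) (a b : R) :
  (forall x, 0 <= h x) -> continuous h ->
  (forall x : R, is_derive x (1 : R) F (h x)) ->
  F (- x) @[x --> +oo] --> a -> F x @[x --> +oo] --> b ->
  (\int[leb]_x (h x)%:E = (b - a)%:E)%E.
Proof.
move=> h0 ch dF Fa Fb.
have mh : measurable_fun setT (EFin \o h).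
  by apply/measurable_EFinP; exact: continuous_measurable_fun.
have cF x : {for x, continuous F}.
  by apply/differentiable_continuous/derivable1_diffP; have [] := dF x.
pose G x := - F (- x).
have dG (x : R) : is_derive x (1 : R) G (h (- x)).
  have := dF (- x); move=> dFx.
  have : is_derive x (1 : R) (F \o -%R) (h (- x) * -1).
    by apply: is_derive1_comp.
  by move=> /is_deriveN; rewrite mulrN1 opprK.
have cG x : {for x, continuous G}.
  by apply/differentiable_continuous/derivable1_diffP; have [] := dG x.
have Ipos : (\int[leb]_(x in `[0%R, +oo[) (h x)%:E = (b - F 0)%:E)%E.
  rewrite (@ge0_continuous_FTC2y _ _ F 0 b)//.
  - exact: continuous_subspaceT.
  - by have := cF 0; exact: cvg_at_right_filter.
  - by move=> x _; rewrite derive1E; have := dF x => ?; exact: derive_val.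
have Ineg : (\int[leb]_(x in `]-oo, 0%R]) (h x)%:E = (F 0 - a)%:E)%E.
  have := @ge0_integration_by_substitution0 R (fun x => (h (- x))%:E).
  under [X in _ -> _ -> _ = X]eq_integral do rewrite opprK.
  move=> <-; last 2 first.
  - apply/measurable_EFinP; apply: continuous_measurable_fun => x.
    by apply: (@continuous_comp _ _ _ -%R h); [exact: opp_continuous|exact: ch].
  - by move=> x; rewrite lee_fin.
  rewrite (@ge0_continuous_FTC2y _ _ G 0 (- a))//.
  - by rewrite /G oppr0 -EFinB; congr EFin; ring.
  - apply: continuous_subspaceT => x.
    by apply: (@continuous_comp _ _ _ -%R h); [exact: opp_continuous|exact: ch].
  - exact: cvgN.
  - by have := cG 0; exact: cvg_at_right_filter.
  - by move=> x _; rewrite derive1E; have := dG x => ?; exact: derive_val.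
rewrite -(setUv `]-oo, 0%R]%classic) ge0_integral_setU//=; last 4 first.
- exact: measurableC.
- by rewrite setUv.
- by move=> x _; rewrite lee_fin.
- exact/disj_setPCl.
rewrite Ineg setCitvl integral_itv_obnd_cbnd; last exact: measurable_funTS.
by rewrite Ipos -EFinD; congr EFin; ring.
Qed.

End line_integral.

(** * The flow of a positive definite matrix *)

Section definite_flow.
Variables (R : realType) (n : nat) (X : 'M[R]_n.+1) (c : R).
Hypothesis c_gt0 : 0 < c.
Hypothesis Xc : forall x : 'cV[R]_n.+1, c * dot_cV x x <= dot_cV x (X^T *m x).
Implicit Types (x : 'cV[R]_n.+1) (a : 'M[R]_n.+1) (t s : R).
Local Notation leb := (@lebesgue_measure R).
Local Notation phi := (fun t : R => expmx (t *: X)).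
Local Notation flow t x := ((phi t)^T *m x).
Local Notation sqn x := (dot_cV x x).
Local Notation Q x := (dot_cV x (X^T *m x)).

Lemma definite_form_ge0 x : 0 <= Q x.
Proof. by apply: le_trans (Xc x); rewrite mulr_ge0 ?dot_cV_ge0// ltW. Qed.

Lemma definite_form_gt0 x : x != 0 -> 0 < Q x.
Proof. by move=> x0; apply: lt_le_trans (Xc x); rewrite mulr_gt0 ?dot_cV_gt0. Qed.

Lemma is_derive_sqn_flow x t :
  is_derive t (1 : R) (fun t => sqn (flow t x)) (2 * Q (flow t x)).
Proof.
pose u t := x^T *m phi t.
have uT s : (u s)^T = flow s x by rewrite /u trmx_mul trmxK.
have du i j : is_derive t (1 : R) (fun t => u t i j) ((u t *m X) i j).
  have -> : u t *m X = 0 *m phi t + x^T *m (phi t *m X).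
    by rewrite mul0mx add0r /u mulmxA.
  apply: is_derive_mulmx => i' j'; first exact: is_derive_cst_mx.
  exact: is_derive_expmxr.
rewrite (_ : (fun t => sqn (flow t x)) = (fun t => (u t *m (u t)^T) 0 0)); last first.
  by apply/funext => s; rewrite /dot_cV -uT trmxK.
have -> : 2 * Q (flow t x) = ((u t *m X) *m (u t)^T + u t *m (u t *m X)^T) 0 0.
  rewrite /dot_cV -uT trmxK [RHS]mxE.
  by rewrite form_trmx (trmx_mul (u t) X); ring.
apply: is_derive_mulmx => // i j; rewrite mxE (_ : (fun t => _) = fun t => u t j i)//.
by apply/funext => s; rewrite mxE.
Qed.

(** Gronwall: by coercivity of Q, |phi(t)^T x|^2 e^{- 2 c t} has a nonnegative derivative. *)
Lemma sqn_flow_growth x s t : s <= t ->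
  sqn (flow s x) * expR (2 * c * (t - s)) <= sqn (flow t x).
Proof.
move=> st; pose m t := sqn (flow t x) * expR (- (2 * c) * t).
have dm (r : R) : is_derive r (1 : R) m
    (expR (- (2 * c) * r) * (2 * (Q (flow r x) - c * sqn (flow r x)))).
  have := is_derive_sqn_flow x r => dsq.
  apply: trigger_derive; rewrite /GRing.scale/=; ring.
have mono : m s <= m t.
  apply: (@ger0_derive1_le_cc _ m s t) => //; rewrite ?in_itv/= ?lexx ?st//.
  - move=> r _; rewrite derive1E; have := dm r => ?; rewrite derive_val.
    by rewrite mulr_ge0 ?expR_ge0// mulr_ge0// subr_ge0 Xc.
  - apply: derivable_within_continuous => r _; by have [] := dm r.
have -> : expR (2 * c * (t - s)) = expR (- (2 * c) * s) * expR (2 * c * t).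
  by rewrite -expRD; congr expR; ring.
rewrite mulrA -ler_pdivlMr ?expR_gt0// -expRN.
by move: mono; rewrite /m [- _ * t]mulNr.
Qed.

Lemma flow_neq0 x t : x != 0 -> flow t x != 0.
Proof.
apply: contra => /eqP h; apply/eqP.
by rewrite -(mulKmx (_ : (phi t)^T \in unitmx) x) ?unitmx_tr ?expmx_unit// h mulmx0.
Qed.

Lemma continuous_flow x i : continuous (fun t => flow t x i 0).
Proof.
rewrite (_ : (fun t => _) = (fun t => \sum_j phi t j i * x j 0)).
  apply: continuous_sum => j; apply: continuous_mul; last exact: cst_continuous.
  move=> t; apply: (@continuous_comp _ _ _ phi (fun a => a j i)).
    exact: continuous_expmx.
  exact: coord_continuous.
by apply/funext => t; rewrite mxE; apply: eq_bigr => j _; rewrite mxE.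
Qed.

Definition gauss_density x := 2 * Q x * expR (- sqn x).

Lemma gauss_density_ge0 x : 0 <= gauss_density x.
Proof. by rewrite !mulr_ge0 ?expR_ge0// definite_form_ge0. Qed.

Lemma gauss_density_gt0 x : x != 0 -> 0 < gauss_density x.
Proof. by move=> x0; rewrite !mulr_gt0 ?expR_gt0// definite_form_gt0. Qed.

Lemma continuous_sqn_comp (T : topologicalType) (f : T -> 'cV[R]_n.+1) :
  (forall i, continuous (fun y => f y i 0)) -> continuous (fun y => sqn (f y)).
Proof.
move=> cf; rewrite (_ : (fun y => _) = (fun y => \sum_i f y i 0 * f y i 0)).
  by apply: continuous_sum => i; exact: continuous_mul.
by apply/funext => y; rewrite dot_cVE.
Qed.

Lemma continuous_gauss_density_comp (T : topologicalType) (f : T -> 'cV[R]_n.+1) :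
  (forall i, continuous (fun y => f y i 0)) ->
  continuous (fun y => gauss_density (f y)).
Proof.
move=> cf; apply: continuous_mul.
  apply: continuous_mul; first exact: cst_continuous.
  rewrite (_ : (fun y => _) =
      (fun y => \sum_i f y i 0 * \sum_j X j i * f y j 0)).
    apply: continuous_sum => i; apply: continuous_mul => //.
    apply: continuous_sum => j; apply: continuous_mul => //.
    exact: cst_continuous.
  apply/funext => y; rewrite dot_cVE; apply: eq_bigr => i _; rewrite mxE.
  by congr (_ * _); apply: eq_bigr => j _; rewrite mxE.
move=> y; apply: (@continuous_comp _ _ _ (fun y => - sqn (f y)) expR).
  by apply: cvgN; apply: continuous_sqn_comp.
exact: continuous_expR.
Qed.

Lemma integral_gauss_density_flow x : x != 0 ->
  (\int[leb]_t (gauss_density (flow t x))%:E = 1)%E.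
Proof.
move=> x0; pose N t := sqn (flow t x).
have N0 : 0 < N 0 by rewrite dot_cV_gt0// flow_neq0.
pose F t := - expR (- N t).
have dF (t : R) : is_derive t (1 : R) F (gauss_density (flow t x)).
  have dN := is_derive_sqn_flow x t.
  apply: trigger_derive; rewrite /GRing.scale/= /gauss_density /N; ring.
rewrite (@ge0_continuous_FTC_line _ _ F (- 1) 0).
- by rewrite opprK add0r.
- by move=> t; exact: gauss_density_ge0.
- by apply: continuous_gauss_density_comp => i; exact: continuous_flow.
- apply: cvgN; rewrite -[X in _ --> X](@expR0 R).
  apply: continuous_cvg; first exact: continuous_expR.
  rewrite -[X in _ --> X](@oppr0 R); apply: cvgN.
  (* Growth from - t to 0 gives N (- t) <= N 0 e^{- 2 c t}. *)
  have : N 0 * expR (- (2 * c * t)) @[t --> +oo] --> N 0 * 0.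
    by apply: cvgMl_tmp; apply: cvg_expRNM; rewrite mulr_gt0.
  rewrite mulr0 => h; apply: squeeze_cvgr h; last exact: cvg_cst.
  near=> t; rewrite dot_cV_ge0/= expRN ler_pdivlMr ?expR_gt0//.
  have := @sqn_flow_growth x (- t) 0; rewrite oppr_le0 opprK add0r; apply.
  by near: t; exact: nbhs_pinfty_ge.
- rewrite -[X in _ --> X](@oppr0 R); apply: cvgN.
  (* Growth from 0 to t gives N t >= N 0 e^{2 c t}, of which the linear lower bound 2 c t N 0 is
     enough. *)
  have h : expR (- (N 0 * (2 * c) * t)) @[t --> +oo] --> 0.
    by apply: cvg_expRNM; rewrite !mulr_gt0.
  apply: squeeze_cvgr h; last exact: cvg_cst.
  near=> t; rewrite expR_ge0/= ler_expR lerN2.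
  have t0 : 0 <= t by near: t; exact: nbhs_pinfty_ge.
  apply: le_trans (sqn_flow_growth x t0); rewrite -mulrA subr0.
  by rewrite -/(N 0) ler_wpM2l ?(ltW N0)// (le_trans _ (expR_ge1Dx _))// lerDr.
Unshelve. all: by end_near. Qed.

(** The squared Frobenius norm. On the group it is the sum of the squared norms of the orbits of the
    basis vectors, so it grows strictly with t and serves as a clock readable from the matrix. *)
Definition frob a := \sum_i \sum_j a i j ^+ 2.

Lemma frob_ge0 a : 0 <= frob a.
Proof. by apply: sumr_ge0 => i _; apply: sumr_ge0 => j _; exact: sqr_ge0. Qed.

Lemma frob_gt0 a : a \in unitmx -> 0 < frob a.
Proof.
move=> au; rewrite lt_neqAle frob_ge0 andbT eq_sym; apply/negP => /eqP.
move=> /eqP; rewrite psumr_eq0 => [/allP h|i _]; last first.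
  by apply: sumr_ge0 => j _; exact: sqr_ge0.
have a0 : a = 0.
  apply/matrixP => i j; have := h i (mem_index_enum i).
  rewrite psumr_eq0 => [/allP /(_ j (mem_index_enum j))|k _]; last exact: sqr_ge0.
  by rewrite /= sqrf_eq0 mxE => /eqP.
by move: au; rewrite a0 unitr0.
Qed.

Lemma continuous_frob : continuous frob.
Proof.
rewrite (_ : frob = fun a => \sum_i \sum_j a i j * a i j).
  apply: continuous_sum => i; apply: continuous_sum => j.
  by apply: continuous_mul; exact: coord_continuous.
apply/funext => a; apply: eq_bigr => i _; apply: eq_bigr => j _.
by rewrite expr2.
Qed.

Lemma frob_expmx t : frob (phi t) = \sum_i sqn (flow t (delta_mx i 0)).
Proof.
apply: eq_bigr => i _; rewrite dot_cVE; apply: eq_bigr => j _.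
by rewrite -colE !mxE expr2.
Qed.

Lemma frob_growth s t : s <= t ->
  frob (phi s) * expR (2 * c * (t - s)) <= frob (phi t).
Proof.
move=> st; rewrite !frob_expmx mulr_suml; apply: ler_sum => i _.
exact: sqn_flow_growth.
Qed.

Lemma frob_lt s t : s < t -> frob (phi s) < frob (phi t).
Proof.
move=> st; apply: lt_le_trans (frob_growth (ltW st)).
by rewrite ltr_pMr ?frob_gt0 ?expmx_unit// pexpR_gt1// !mulr_gt0// subr_gt0.
Qed.

Lemma frob_le s t : (frob (phi s) <= frob (phi t)) = (s <= t).
Proof.
have [st|ts|->] := ltgtP s t; last by rewrite lexx.
  by rewrite ltW// frob_lt.
by apply/negbTE; rewrite -ltNge frob_lt.
Qed.

(** Quantitative properness: r prevents escape to -oo, where phi t tends to the zero matrix, and m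
    prevents escape to +oo. *)
Lemma expmx_time_bound r m : 0 < r -> exists T : R,
  forall t, r <= frob (phi t) -> frob (phi t) <= m -> t \in `[- T, T].
Proof.
move=> r0; pose f := frob (phi 0).
have f0 : 0 < f by rewrite frob_gt0// expmx_unit.
have k0 : 0 < 2 * c by rewrite mulr_gt0.
(* For t >= 0, m >= f e^{2 c t} >= 2 c t f; for t < 0, f >= r e^{- 2 c t} >= - 2 c t r. The absolute
   value keeps the first term nonnegative for every m. *)
exists (`|m| / (f * (2 * c)) + f / r / (2 * c)) => t rt tm.
have p1 : 0 <= `|m| / (f * (2 * c)) by rewrite divr_ge0// ltW// mulr_gt0.
have p2 : 0 <= f / r / (2 * c) by rewrite !divr_ge0// ltW.
rewrite in_itv/=; have [t0|t0] := leP 0 t.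
  apply/andP; split; first by lra.
  suff : t <= `|m| / (f * (2 * c)) by lra.
  rewrite ler_pdivlMr ?mulr_gt0// (le_trans _ (ler_norm m))// (le_trans _ tm)//.
  apply: le_trans (frob_growth t0); rewrite subr0 mulrCA -/f ler_wpM2l ?(ltW f0)//.
  by rewrite mulrC (le_trans _ (expR_ge1Dx _))// lerDr.
apply/andP; split; last by lra.
suff : - t <= f / r / (2 * c) by lra.
rewrite ler_pdivlMr// ler_pdivlMr// mulrC.
have := frob_growth (ltW t0); rewrite sub0r -/f => /(le_trans _); apply.
rewrite ler_pM ?(ltW r0)//; first by rewrite mulr_ge0 ?(ltW k0)// oppr_ge0 ltW.
by rewrite mulrC (le_trans _ (expR_ge1Dx _))// lerDr.
Qed.

Local Notation G := [set phi t | t in [set: R]].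

Lemma compact_expmx_itv (u v : R) : compact (phi @` `[u, v]).
Proof.
apply: continuous_compact; last exact: segment_compact.
by apply: continuous_subspaceT; exact: continuous_expmx.
Qed.

Lemma closed_expmx_itv (u v : R) : closed (phi @` `[u, v]).
Proof. by apply: compact_closed (@compact_expmx_itv u v); exact: norm_hausdorff. Qed.

(** G accumulates at the zero matrix, so closedness holds only inside GL_n. Near an invertible a of
    the closure, [frob] stays between frob a / 2 and frob a + 1; this bounds the times involved, and
    a lies in a compact arc. *)
Lemma closed_subgroup_expmx : closed_subgroup_GL G.
Proof.
split.
- by move=> _ [t _ <-]; exact: expmx_unit.
- by exists 0 => //; exact: expmx0.
- by move=> _ _ [s _ <-] [t _ <-]; exists (s + t) => //; rewrite expmxD.
- by move=> _ [t _ <-]; exists (- t) => //; rewrite invmx_expmx.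
move=> a [aG /= au]; have a0 := frob_gt0 au.
have a2 : 0 < frob a / 2 by rewrite divr_gt0.
have [T HT] := expmx_time_bound (frob a + 1) a2.
have aT : closure (phi @` `[- T, T]) a.
  move=> V aV.
  have aU : nbhs a [set b | `|frob a - frob b| < minr (frob a / 2) 1].
    have /cvgrPdist_lt := @continuous_frob a.
    by apply; rewrite lt_min a2/=.
  have [_ [[t _ <-] [Vt /=]]] := aG _ (filterI aV aU).
  rewrite lt_min => /andP[h1 h2]; exists (phi t); split => //.
  exists t => //; apply: HT.
    by move: h1; rewrite ltr_norml => /andP[_]; lra.
  by move: h2; rewrite ltr_norml => /andP[]; lra.
have [t _ <-] : (phi @` `[- T, T]) a 
  by move/closure_id : (@closed_expmx_itv (- T) T) => ->.
by exists t.
Qed.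

Let mphi : measurable_fun setT phi.
Proof.
apply: (@measurability _ _ _ _ setT phi (@open 'M[R]_n.+1) (erefl _)).
move=> _ [U oU <-]; rewrite setTI; apply: open_measurable.
by move/continuousP: (@continuous_expmx R _ X); apply.
Qed.

Let mexpmx_itv (u v : R) : measurable (phi @` `[u, v]).
Proof.
rewrite -[X in measurable X]setCK; apply: measurableC; apply: open_measurable_mx.
by rewrite openC; exact: closed_expmx_itv.
Qed.

Let G_bigcup : G = \bigcup_(k : nat) (phi @` `[- k%:R, k%:R]).
Proof.
apply/seteqP; split => [_ [t _ <-]|_ [k _ [t _ <-]]]; last by exists t.
exists (truncn `|t|).+1 => //; exists t => //=.
by rewrite in_itv/= -ler_norml ltW// truncnS_gt.
Qed.

Let mG : measurable G.
Proof. by rewrite G_bigcup; exact: bigcupT_measurable. Qed.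

(** [frob] attains its minimum and maximum on K, and the minimum is positive by invertibility, so
    [expmx_time_bound] applies. *)
Lemma compact_expmx_bounded (K : set 'M[R]_n.+1) : compact K -> K `<=` G ->
  exists T : R, phi @^-1` K `<=` `[- T, T].
Proof.
move=> cK KG; have [K0|K0] := pselect (K !=set0); last first.
  by exists 0 => t /= Kt; exfalso; apply: K0; exists (phi t).
have cf : {within K, continuous frob}.
  by apply: continuous_subspaceT; exact: continuous_frob.
have [b /set_mem Kb maxb] := compact_EVT_max K0 cK cf.
have [a /set_mem Ka mina] := compact_EVT_min K0 cK cf.
have a0 : 0 < frob a by have [t _ <-] := KG _ Ka; rewrite frob_gt0// expmx_unit.
have [T HT] := expmx_time_bound (frob b) a0.
by exists T => t /= Kt; apply: HT; [apply: mina|apply: maxb]; rewrite inE.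
Qed.

Lemma lebesgue_measure_translate (s : R) (A : set R) : measurable A ->
  leb [set t | A (s + t)] = leb A.
Proof.
move=> mA; have := @ge0_integral_affine R s 1 (fun t => (\1_A t)%:E) ltr01.
rewrite integral_indic// setIT mul1e => ->; last 2 first.
- by apply/measurable_EFinP; exact: measurable_indic.
- by move=> t; rewrite lee_fin.
have mB : measurable [set t | A (s + t)].
  rewrite -[X in measurable X]setTI.
  by apply: (measurable_funD (measurable_cst s) (@measurable_id _ _ setT)).
transitivity (\int[leb]_t (\1_[set t | A (s + t)] t)%:E)%E.
  by rewrite integral_indic// setIT.
by apply: eq_integral => t _; rewrite mul1r; congr EFin; exact: eq_indic.
Qed.

(** The pushforward of Lebesgue measure by phi: the group law turns left invariance into translation
    invariance, and properness gives finiteness on compact sets. *)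
Lemma exists_left_haar_expmx : exists mu, left_haar_measure G mu.
Proof.
pose mu : {measure set 'M[R]_n.+1 -> \bar R} :=
  measure_function_pushforward__canonical__measure_function_Measure leb mphi.
have muE E : mu E = leb (phi @^-1` E) by [].
exists mu; split.
- rewrite muE (_ : _ @^-1` _ = set0) ?measure0//.
  by apply/seteqP; split => // t /= nG; apply: nG; exists t.
- rewrite muE (_ : _ @^-1` _ = setT); last first.
    by apply/seteqP; split=> // t _; exists t.
  apply: (@lt_le_trans _ _ (leb `[0, 1]%classic)).
    by rewrite lebesgue_measure_itv/= lte_fin ltr01 -EFinB subr0 lte_fin.
  by apply: le_measure; rewrite ?inE.
- move=> K cK KG; have [T KT] := compact_expmx_bounded cK KG.
  have mK : measurable (phi @^-1` K).
    rewrite -[X in measurable X]setTI; apply: mphi => //.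
    rewrite -[K]setCK; apply: measurableC; apply: open_measurable_mx.
    by rewrite openC; apply: compact_closed cK; exact: norm_hausdorff.
  rewrite muE; apply: (@le_lt_trans _ _ (leb `[- T, T]%classic)).
    by apply: le_measure; rewrite ?inE.
  by rewrite lebesgue_measure_itv/=; case: ifPn => // _; rewrite -EFinB ltry.
- move=> _ E [s _ <-] mE; rewrite !muE.
  have mphiE : measurable (phi @^-1` E).
    by rewrite -[X in measurable X]setTI; exact: mphi.
  rewrite -(lebesgue_measure_translate (- s) mphiE); congr (leb _).
  apply/seteqP; split => t /=.
    by move=> [b Eb] bt; rewrite expmxD -bt mulmxA expmxNl mul1mx.
  by move=> Et; exists (phi (- s + t)) => //; rewrite -expmxD addrA subrr add0r.
Qed.

Lemma measurable_gauss_density_comp d (U : measurableType d) (f : U -> 'cV[R]_n.+1) :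
  (forall i, measurable_fun setT (fun y => f y i 0)) ->
  measurable_fun setT (fun y => gauss_density (f y)).
Proof.
move=> mf.
rewrite (_ : (fun y => _) = (fun y =>
    2 * (\sum_i f y i 0 * \sum_j X j i * f y j 0) *
    expR (- \sum_i f y i 0 * f y i 0))); last first.
  apply/funext => y; rewrite /gauss_density !dot_cVE; congr (_ * _ * _).
  by apply: eq_bigr => i _; rewrite mxE; under eq_bigr do rewrite mxE.
apply: measurable_funM.
  apply: measurable_funM => //; apply: measurable_sum => i.
  apply: measurable_funM => //; apply: measurable_sum => j.
  exact: measurable_funM.
apply: measurableT_comp => //; apply: measurableT_comp => //.
by apply: measurable_sum => i; exact: measurable_funM.
Qed.

(** * Integration against an arbitrary left Haar measure *)

Section haar_integral.
Variable mu : {sigma_finite_measure set 'M[R]_n.+1 -> \bar R}.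
Hypothesis haar : left_haar_measure G mu.

(** Invariance is given on images; the preimage under multiplication by phi s is the image under
    multiplication by phi (- s). *)
Let haar_translate s (f : 'M[R]_n.+1 -> \bar R) : measurable_fun setT f ->
  (forall a, 0 <= f a)%E ->
  (\int[mu]_a f (phi s *m a) = \int[mu]_a f a)%E.
Proof.
move=> mf f0; have [_ _ _ inv] := haar.
have mL : measurable_fun setT (fun a : 'M[R]_n.+1 => phi s *m a).
  apply: continuous_measurable_mx => a; apply: (@cvg_mx _ _ (nbhs a)) => i j.
  have -> : (fun b : 'M[R]_n.+1 => (phi s *m b) i j) =
      (fun b => \sum_l phi s i l * b l j) by apply/funext => b; rewrite mxE.
  have : continuous (fun b : 'M[R]_n.+1 => \sum_l phi s i l * b l j).
    apply: continuous_sum => l; apply: continuous_mul; last exact: coord_continuous.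
    exact: cst_continuous.
  by move=> /(_ a); rewrite mxE.
pose nu : {measure set 'M[R]_n.+1 -> \bar R} :=
  measure_function_pushforward__canonical__measure_function_Measure mu mL.
transitivity (\int[nu]_a f a)%E; last first.
  apply: eq_measure_integral => E mE _.
  rewrite /nu/= /pushforward -(inv (phi (- s)) E)//; congr (mu _).
  apply/seteqP; split => a /=.
    by move=> Ea; exists (phi s *m a) => //; rewrite mulmxA expmxNl mul1mx.
  by move=> [b Eb <-]; rewrite mulmxA expmxN mul1mx.
by rewrite ge0_integral_pushforward//= preimage_setT.
Qed.

(* As frob (phi t) increases with t, each orbit spends exactly unit time in the
   slab. *)
Let slab : set R := `[frob (phi 0), frob (phi 1)[%classic.

Let slab_phi t : slab (frob (phi t)) <-> 0 <= t < 1.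
Proof.
rewrite /slab/= in_itv/= frob_le; split=> /andP[-> ] h.
  by rewrite ltNge -frob_le -ltNge.
by rewrite ltNge frob_le -ltNge.
Qed.

Let indic_slab t : \1_slab (frob (phi t)) = \1_(`[0, 1[%classic) t :> R.
Proof.
by apply: eq_indic; rewrite slab_phi /= in_itv.
Qed.

Let mindic_slab d (U : measurableType d) (f : U -> 'M[R]_n.+1) :
  (forall i j, measurable_fun setT (fun y => f y i j)) ->
  measurable_fun setT (fun y => \1_slab (frob (f y)) : R).
Proof.
move=> mf; have ms : measurable slab by exact: measurable_itv.
have mfrob : measurable_fun setT (fun y => frob (f y)).
  apply: measurable_sum => i; apply: measurable_sum => j.
  exact: measurable_funX.
exact: measurableT_comp (measurable_indic ms) mfrob.
Qed.

(** The sign serves both integrands of the Fubini argument, one with phi s and the other with phi (-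
    s). *)
Let mphi_mul (sgn : R) i j : measurable_fun setT
  (fun p : 'M[R]_n.+1 * R => (phi (sgn * p.2) *m p.1) i j).
Proof.
rewrite (_ : (fun p => _) = (fun p : 'M[R]_n.+1 * R =>
    \sum_l phi (sgn * p.2) i l * p.1 l j)); last first.
  by apply/funext => p; rewrite mxE.
apply: measurable_sum => l; apply: measurable_funM.
  apply: (@measurableT_comp _ _ _ _ _ _ (fun t => phi t i l) _
    (fun p : 'M[R]_n.+1 * R => sgn * p.2)).
    exact: measurableT_comp (@measurable_coord_mx R _ _ i l) mphi.
  by apply: measurable_funM => //; exact: measurable_snd.
exact: measurableT_comp (@measurable_coord_mx R _ _ l j) measurable_fst.
Qed.

Let trmulE (f : 'M[R]_n.+1) x i : (f^T *m x) i 0 = \sum_j f j i * x j 0.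
Proof. by rewrite mxE; apply: eq_bigr => j _; rewrite mxE. Qed.

(** The point is that the right-hand side is free of x. It rests on two inner integrals over the
    line equal to 1: that of the density along an orbit, and the time an orbit spends in the
    slab. *)
Lemma haar_integral_gauss_density x : x != 0 ->
  (\int[mu]_(a in G) (gauss_density (a^T *m x))%:E =
   mu (G `&` frob @^-1` slab))%E.
Proof.
move=> x0; pose H a := gauss_density (a^T *m x).
have H0 a : 0 <= H a by exact: gauss_density_ge0.
have mH d (U : measurableType d) (f : U -> 'M[R]_n.+1) :
    (forall i j, measurable_fun setT (fun y => f y i j)) ->
    measurable_fun setT (fun y => H (f y)).
  move=> mf; apply: measurable_gauss_density_comp => i.
  rewrite (_ : (fun y => _) = (fun y => \sum_j f y j i * x j 0)).
    by apply: measurable_sum => j; exact: measurable_funM.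
  by apply/funext => y; rewrite trmulE.
have GM s a : \1_G (phi s *m a) = \1_G a :> R.
  apply: eq_indic; split => -[t _].
    move=> e; exists (- s + t) => //.
    by rewrite expmxD e mulmxA expmxNl mul1mx.
  by move=> <-; exists (s + t) => //; rewrite expmxD.
have indic0 (T : Type) (A : set T) y : 0 <= \1_A y :> R by rewrite indicE.
(* Integrate f1 over G x R in both orders: the substitution a |-> phi (- s) a in the
   inner integral over G turns f1 into f2. *)
pose f1 (p : 'M[R]_n.+1 * R) : \bar R :=
  (\1_G p.1 * \1_slab (frob p.1) * H (phi (1 * p.2) *m p.1))%:E.
pose f2 (p : 'M[R]_n.+1 * R) : \bar R :=
  (\1_G p.1 * \1_slab (frob (phi (-1 * p.2) *m p.1)) * H p.1)%:E.
have mcoord i j : measurable_fun setT (fun p : 'M[R]_n.+1 * R => p.1 i j).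
  exact: measurableT_comp (@measurable_coord_mx R _ _ i j) measurable_fst.
have mG1 : measurable_fun setT (fun p : 'M[R]_n.+1 * R => \1_G p.1 : R).
  exact: measurableT_comp (measurable_indic mG) measurable_fst.
have mf1 : measurable_fun setT f1.
  apply/measurable_EFinP; apply: measurable_funM.
    by apply: measurable_funM => //; exact: mindic_slab.
  by apply: mH; exact: mphi_mul.
have mf2 : measurable_fun setT f2.
  apply/measurable_EFinP; apply: measurable_funM.
    by apply: measurable_funM => //; apply: mindic_slab; exact: mphi_mul.
  exact: mH.
have f1_ge0 p : (0 <= f1 p)%E by rewrite lee_fin; apply: mulr_ge0; first exact: mulr_ge0.
have f2_ge0 p : (0 <= f2 p)%E by rewrite lee_fin; apply: mulr_ge0; first exact: mulr_ge0.
have E1 : (\int[mu]_a \int[leb]_s f1 (a, s) = mu (G `&` frob @^-1` slab))%E.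
  have mK : measurable (G `&` frob @^-1` slab).
    apply: measurableI => //; rewrite -[X in measurable X]setTI.
    apply: (continuous_measurable_mxR continuous_frob) => //; exact: measurable_itv.
  transitivity (\int[mu]_a (\1_(G `&` frob @^-1` slab) a)%:E)%E; last first.
    by rewrite integral_indic// setIT.
  apply: eq_integral => a _.
  rewrite indicI /f1 /=; have [Ga|nGa] := pselect (G a); last first.
    rewrite [\1_G a]indicE memNset// mul0r integral0_eq// => s _.
    by rewrite !mul0r.
  have [t _ ta] := Ga.
  rewrite [\1_G a]indicE mem_set// mul1r.
  have mHa : measurable_fun [set: R] (fun s : R => (H (phi (1 * s) *m a))%:E).
    apply/measurable_EFinP; apply: mH => i j.
    exact: measurableT_comp (mphi_mul 1 i j) (measurable_pair1 a).
  under eq_integral do rewrite EFinM.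
  rewrite (ge0_integralZl_lebesgue mHa)//; last by move=> s; rewrite lee_fin.
  rewrite [X in (_ * X)%E](_ : _ = 1%E) ?mule1//.
  (* For a = phi t, this is the integral of the density along the orbit of phi(t)^T x, which is
     nonzero. *)
  rewrite -(integral_gauss_density_flow (flow_neq0 t x0)); apply: eq_integral => s _.
  congr (gauss_density _)%:E; rewrite -ta mulmxA -trmx_mul -!expmxD mul1r.
  by rewrite (addrC s).
have E2 : (\int[mu]_a \int[leb]_s f2 (a, s) = \int[mu]_(a in G) (H a)%:E)%E.
  rewrite [RHS]integral_mkcond; apply: eq_integral => a _.
  rewrite patchE /f2 /=; case: ifPn => [/set_mem Ga|nGa]; last first.
    by rewrite integral0_eq// => s _; rewrite [\1_G a]indicE (negPf nGa) !mul0r.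
  have [t _ ta] := Ga.
  have ms : measurable_fun [set: R]
      (fun s : R => (\1_slab (frob (phi (-1 * s) *m a)) : R)%:E).
    apply/measurable_EFinP; apply: mindic_slab => i j.
    exact: measurableT_comp (mphi_mul (-1) i j) (measurable_pair1 a).
  under eq_integral do rewrite [\1_G a]indicE mem_set// mul1r mulrC EFinM.
  rewrite (ge0_integralZl_lebesgue ms)//.
  rewrite [X in (_ * X)%E](_ : _ = 1%E) ?mule1//.
  (* For a = phi t, the matrix phi (- s) a = phi (t - s) is in the slab exactly when 0 <= t - s <
     1. *)
  transitivity (\int[leb]_s (\1_(`]t - 1, t]%classic) s)%:E)%E.
    apply: eq_integral => s _; rewrite -ta -expmxD indic_slab; congr EFin.
    apply: eq_indic; rewrite /= !in_itv/= mulN1r.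
    by split=> /andP[? ?]; apply/andP; split; lra.
  transitivity (leb `]t - 1, t]%classic); first by rewrite integral_indic// setIT.
  rewrite lebesgue_measure_itv/= lte_fin gtrBl ltr01.
  by rewrite -EFinB; congr EFin; ring.
have F1 : (\int[mu]_a \int[leb]_s f1 (a, s) = \int[leb]_s \int[mu]_a f1 (a, s))%E.
  exact: fubini_tonelli.
have F2 : (\int[mu]_a \int[leb]_s f2 (a, s) = \int[leb]_s \int[mu]_a f2 (a, s))%E.
  exact: fubini_tonelli.
transitivity (\int[mu]_a \int[leb]_s f2 (a, s))%E; first exact/esym.
transitivity (\int[mu]_a \int[leb]_s f1 (a, s))%E; last by [].
apply: (etrans F2); apply: (etrans _ (esym F1)).
apply: eq_integral => s _.
rewrite -(@haar_translate s (fun a => f2 (a, s))); last 2 first.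
- exact: measurableT_comp mf2 (measurable_pair2 s).
- by move=> a; exact: f2_ge0.
apply: eq_integral => a _; rewrite /f1 /f2 /= GM mulN1r mul1r.
by rewrite mulmxA expmxNl mul1mx.
Qed.

(** The part of G in the slab is contained in the compact arc phi([0, 1]). *)
Lemma haar_integral_gauss_density_lty x : x != 0 ->
  (\int[mu]_(a in G) (gauss_density (a^T *m x))%:E < +oo)%E.
Proof.
move=> x0; rewrite haar_integral_gauss_density//; have [_ _ fin _] := haar.
apply: (@le_lt_trans _ _ (mu (phi @` `[0, 1]))).
  apply: le_measure; rewrite ?inE//.
    apply: measurableI => //; rewrite -[X in measurable X]setTI.
    apply: (continuous_measurable_mxR continuous_frob) => //; exact: measurable_itv.
  move=> _ [[t _ <-] /slab_phi /andP[t0 t1]]; exists t => //=.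
  by rewrite in_itv/= t0 ltW.
apply: fin; first exact: compact_expmx_itv.
by move=> _ [t _ <-].
Qed.

(** The density is positive at every a^T x with a in G, so a zero integral would force mu G = 0. *)
Lemma haar_integral_gauss_density_gt0 x : x != 0 ->
  (0 < \int[mu]_(a in G) (gauss_density (a^T *m x))%:E)%E.
Proof.
move=> x0; have [_ muG _ _] := haar.
have H0 a : (0 <= (gauss_density (a^T *m x))%:E)%E.
  by rewrite lee_fin gauss_density_ge0.
rewrite lt_neqAle integral_ge0 ?andbT//; apply/eqP => /esym I0.
have mH : measurable_fun G (fun a => (gauss_density (a^T *m x))%:E).
  apply: measurable_funTS; apply/measurable_EFinP.
  apply: measurable_gauss_density_comp => i.
  rewrite (_ : (fun y => _) = (fun y : 'M[R]_n.+1 => \sum_j y j i * x j 0)).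
    apply: measurable_sum => j; apply: measurable_funM => //.
    exact: measurable_coord_mx.
  by apply/funext => y; rewrite trmulE.
have : ae_eq mu G (fun a => (gauss_density (a^T *m x))%:E) (cst 0%E).
  apply/(ae_eq_integral_abs mu mG mH).
  by rewrite -[RHS]I0; apply: eq_integral => a _; rewrite gee0_abs.
move=> [N [mN N0 GN]].
suff : (mu G <= mu N)%E by rewrite N0 leNgt muG.
apply: le_measure; rewrite ?inE// => a Ga; apply: GN => /= /(_ Ga) /eqP.
rewrite eqe gt_eqF// gauss_density_gt0//; have [t _ <-] := Ga.
exact: flow_neq0.
Qed.

End haar_integral.

(** * Decay of the density and construction of the wavelet *)

Lemma definite_form_le x : Q x <= (\sum_i \sum_j `|X j i|) * sqn x.
Proof.
have coord_le i : x i 0 ^+ 2 <= sqn x.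
  rewrite dot_cVE (bigD1 i)//= expr2 lerDl; apply: sumr_ge0 => j _.
  by rewrite -expr2 sqr_ge0.
rewrite dot_cVE mulr_suml; apply: ler_sum => i _.
rewrite mxE mulr_sumr mulr_suml; apply: ler_sum => j _.
rewrite !mxE mulrCA; apply: le_trans (ler_norm _) _; rewrite normrM ler_wpM2l//.
rewrite ler_norml; have := coord_le i; have := coord_le j.
have := sqr_ge0 (x i 0 + x j 0); have := sqr_ge0 (x i 0 - x j 0).
rewrite sqrrB sqrrD; lra.
Qed.

(** The parameter 1 / (2 pi) makes the kernel e^{- (|x_1| + ... + |x_n|)}, already known to be
    integrable; it is squared because the square root of the density is what must be dominated. *)
Lemma gauss_density_le_laplace : exists2 K, 0 <= K &
  forall x, gauss_density x <= K * laplace_cV (2 * pi)^-1 x ^+ 2.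
Proof.
pose L := \sum_i \sum_j `|X j i|.
have L0 : 0 <= L by apply: sumr_ge0 => i _; exact: sumr_ge0.
(* With N = |x|^2 and A the l^1 norm, N / 2 <= e^{N/2} gives 2 L N e^{-N} <= 4 L e^{-N/2}. Summing
   (|x_i| - 2)^2 >= 0 gives N >= 4 A - 4 (n + 1), whence the factor e^{2 (n + 1)}. *)
exists (4 * L * expR (2 * n.+1%:R)); first by rewrite !mulr_ge0// expR_ge0.
move=> x; have pi0 : 2 * pi != 0 :> R by rewrite mulf_neq0// gt_eqF// pi_gt0.
have -> : laplace_cV (2 * pi)^-1 x = expR (- \sum_i `|x i 0|).
  by rewrite laplace_cVE; congr (expR (- _)); rewrite mulrAC divff// mul1r.
set N := sqn x; set A := \sum_i _.
have N0 : 0 <= N by exact: dot_cV_ge0.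
have NA : 4 * A - 4 * n.+1%:R <= N.
  rewrite /N dot_cVE /A; have -> : n.+1%:R = \sum_(i < n.+1) 1 :> R.
    by rewrite sumr_const card_ord.
  rewrite !mulr_sumr -sumrB; apply: ler_sum => i _.
  have -> : x i 0 * x i 0 = `|x i 0| ^+ 2 by rewrite real_normK ?num_real ?expr2.
  by have := sqr_ge0 (`|x i 0| - 2); rewrite sqrrB; lra.
apply: (@le_trans _ _ (4 * L * expR (- (N / 2)))).
  rewrite /gauss_density.
  apply: (@le_trans _ _ (2 * (L * N) * expR (- N))).
    by rewrite ler_wpM2r ?expR_ge0// ler_wpM2l// definite_form_le.
  have -> : - N = - (N / 2) + - (N / 2) by lra.
  rewrite expRD [leLHS]mulrA ler_wpM2r ?expR_ge0//.
  have -> : 4 * L = 2 * L * 2 by ring.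
  rewrite (mulrA 2 L N) -(mulrA (2 * L)) ler_wpM2l ?mulr_ge0// expRN.
  rewrite ler_pdivrMr ?expR_gt0//.
  by have := expR_ge1Dx (N / 2); lra.
rewrite -[leRHS]mulrA ler_wpM2l ?mulr_ge0// expr2 -!expRD ler_expR.
lra.
Qed.

Lemma exists_inverse_fourier_gauss (m : R) : 0 < m ->
  exists psi, is_fourierL2 psi (fun x => (sqrtr (gauss_density x / m))%:C%C).
Proof.
move=> m0; have [K K0 HK] := gauss_density_le_laplace.
pose g x := sqrtr (gauss_density x / m); pose C := sqrtr (K / m).
have e0 : 0 < (2 * pi)^-1 :> R by rewrite invr_gt0 mulr_gt0// pi_gt0.
have gle x : g x <= C * laplace_cV (2 * pi)^-1 x.
  have lge0 := ltW (laplace_cV_gt0 (2 * pi)^-1 x).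
  rewrite -(ger0_norm lge0) -sqrtr_sqr -sqrtrM; last by rewrite divr_ge0// ltW.
  by apply: ler_wsqrtr; rewrite [leRHS]mulrAC ler_wpM2r ?invr_ge0 ?(ltW m0).
have cg : continuous g.
  move=> x; apply: (@continuous_comp _ _ _ (fun x => gauss_density x / m) sqrtr).
    apply: continuous_mul; last exact: cst_continuous.
    by apply: continuous_gauss_density_comp => i; exact: coord_continuous.
  exact: sqrt_continuous.
apply: (@exists_inverse_fourier R n.+1 g C) => //.
- by move=> x; exact: sqrtr_ge0.
- move=> x; apply: le_trans (gle x) _; rewrite ler_piMr ?sqrtr_ge0//.
  by rewrite laplace_cV_le1// ltW.
- have [iL _] := laplace_cV_fourier n.+1 e0.
  have mg : measurable_fun setT (EFin \o g).
    by apply/measurable_EFinP; exact: continuous_measurable_mxR.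
  apply: (le_integrable measurableT mg _ (integrableZl measurableT C iL)).
  move=> x _ /=; rewrite lee_fin !ger0_norm ?sqrtr_ge0 ?gle//.
  by rewrite mulr_ge0 ?sqrtr_ge0// ltW// laplace_cV_gt0.
Qed.

(** Needed for Fubini. The cover consists of compact arcs, each enlarged by the null complement of
    G. *)
Lemma left_haar_sigma_finite (mu : {measure set 'M[R]_n.+1 -> \bar R}) :
  left_haar_measure G mu -> sigma_finite setT mu.
Proof.
move=> [muG _ fin _].
exists (fun k : nat => phi @` `[- k%:R, k%:R] `|` ~` G).
  apply/seteqP; split => // a _; have [|nGa] := pselect (G a).
    by rewrite G_bigcup => -[k _ ka]; exists k => //; left.
  by exists 0%N => //; right.
move=> k; have mGC : measurable (~` G) by exact: measurableC.
split; first exact: measurableU.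
apply: (le_lt_trans (measureU2 mu (mexpmx_itv _ _) mGC)).
rewrite [X in (_ + X)%E](_ : _ = 0%E)// adde0; apply: fin; first exact: compact_expmx_itv.
by move=> _ [t _ <-].
Qed.

Lemma haar_wavelet (mu : {sigma_finite_measure set 'M[R]_n.+1 -> \bar R}) :
  left_haar_measure G mu -> exists psi psihat : 'cV[R]_n.+1 -> R[i],
    is_fourierL2 psi psihat /\
    {ae lebesgue_cV R n.+1, forall x, x != 0 -> Delta G mu psihat x = 1%E}.
Proof.
move=> haar; pose I x := (\int[mu]_(a in G) (gauss_density (a^T *m x))%:E)%E.
have [m m0 Im] : exists2 m : R, 0 < m & forall x, x != 0 -> I x = m%:E.
  (* Any nonzero reference vector will do to define the constant m. *)
  have x10 : (const_mx 1 : 'cV[R]_n.+1) != 0.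
    by apply/negP => /eqP/matrixP/(_ 0 0)/eqP; rewrite !mxE oner_eq0.
  have fI := haar_integral_gauss_density_lty haar x10.
  have I0 := haar_integral_gauss_density_gt0 haar x10.
  exists (fine (I (const_mx 1))); first by rewrite fine_gt0// I0.
  move=> x x0; rewrite fineK; last by rewrite ge0_fin_numE// ltW.
  by rewrite /I !haar_integral_gauss_density.
have [psi psiF] := exists_inverse_fourier_gauss m0.
exists psi, (fun x => (sqrtr (gauss_density x / m))%:C%C); split => //.
apply: aeW => x x0; rewrite /Delta.
transitivity (\int[mu]_(a in G) (m^-1%:E * (gauss_density (a^T *m x))%:E))%E.
  apply: eq_integral => a _; rewrite sqr_normcE/= expr0n addr0 sqr_sqrtr.
    by rewrite -EFinM mulrC.
  by rewrite divr_ge0 ?gauss_density_ge0// ltW.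
rewrite ge0_integralZl//.
- by rewrite -/(I x) Im// -EFinM mulVf// gt_eqF.
- apply: measurable_funTS; apply/measurable_EFinP.
  apply: measurable_gauss_density_comp => i.
  rewrite (_ : (fun y => _) = (fun y : 'M[R]_n.+1 => \sum_j y j i * x j 0)).
    apply: measurable_sum => j; apply: measurable_funM => //.
    exact: measurable_coord_mx.
  by apply/funext => y; rewrite mxE; apply: eq_bigr => j _; rewrite mxE.
- by move=> a _; rewrite lee_fin gauss_density_ge0.
- by rewrite lee_fin invr_ge0 ltW.
Qed.

Lemma admissible_expmx : admissible G.
Proof.
split; [exact: closed_subgroup_expmx|exact: exists_left_haar_expmx|move=> mu haar].
have sfmu := left_haar_sigma_finite haar.
pose sfin := isSFinite.Build _ _ _ _ (sfinite_measure_sigma_finite sfmu).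
pose sigfin := isSigmaFinite.Build _ _ _ _ sfmu.
pose smu : {sigma_finite_measure set 'M[R]_n.+1 -> \bar R} :=
  HB.pack_for (SigmaFiniteMeasure.type _ R) (Measure.sort mu) sfin sigfin.
have smuE : mu = smu by exact: eq_measure.
by rewrite smuE; apply: haar_wavelet; rewrite -smuE.
Qed.

End definite_flow.

Theorem corollary2p5 (R : realType) (n : nat) (X : 'M[R]_n)
    (n_gt0 : (0 < n)%N)
    (hX : eigenvalues_same_sign (2^-1 *: (X + X^T))) :
  admissible [set expmx (t *: X) | t in [set: R]].
Proof.
case: n n_gt0 X hX => // n _.
have pos (X : 'M[R]_n.+1) :
    (forall r, eigenvalue (2^-1 *: (X + X^T)) r -> 0 < r) ->
    admissible [set expmx (t *: X) | t in [set: R]].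
  by move=> /definite_quadratic_form[c c0 Xc]; exact: admissible_expmx c0 Xc.
(* The sign hypothesis concerns complex eigenvalues, whereas coercivity uses real ones; extension of
   scalars links them. *)
have real_eig (S : 'M[R]_n.+1) r : eigenvalue S r ->
    eigenvalue (map_mx (real_complex R) S) (r%:C)%C.
  by rewrite -(eigenvalue_map (real_complex R)).
move=> X [] h.
  by apply: pos => r /real_eig/h[s [->]].
rewrite (_ : [set _ | _ in _] = [set expmx (t *: - X) | t in [set: R]]).
  apply: pos => r; rewrite linearN/= -opprD scalerN.
  move=> /eigenvalueP[v vr v0].
  suff /real_eig/h[s [<-]] : eigenvalue (2^-1 *: (X + X^T)) (- r).
    by rewrite oppr_lt0.
  by apply/eigenvalueP; exists v => //; rewrite scaleNr -vr mulmxN opprK.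
by apply/seteqP; split => _ [t _ <-]; exists (- t) => //; rewrite scalerN scaleNr ?opprK.
Qed.
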